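(* Let $D$ be an integral domain with quotient field $K$ and let $\Theta$ be a Jaffard family of $D$. Let $E\subseteq K$ be a subset such that $dE\subseteq D$ for some $d\in D$, $d\neq 0$. Then $$\mathrm{LPic}(\mathrm{Int}(E,D),D)\simeq\bigoplus_{T\in\Theta}\mathrm{LPic}(\mathrm{Int}(E,T),T)$$ and $$\mathrm{LPic}(\mathrm{Int}(D),D)\simeq\bigoplus_{T\in\Theta}\mathrm{LPic}(\mathrm{Int}(T),T).$$
   Context: $D$ is an integral domain that is not a field, with quotient field $K\neq D$. For a domain $A$ with quotient field $K$ and $E\subseteq K$, $\mathrm{Int}(E,A):=\{f\in K[X]\mid f(E)\subseteq A\}$ is the ring of integer-valued polynomials on $E$, and $\mathrm{Int}(A):=\mathrm{Int}(A,A)$. $\mathrm{Pic}(B)$ is the group of invertible fractional ideals of the domain $B$ modulo nonzero principal fractional ideals. For an extension $A\subseteq B$ of integral domains, the local Picard group is $\mathrm{LPic}(B,A):=\mathrm{Pic}(B)/\iota(\mathrm{Pic}(A))$, where $\iota:\mathrm{Pic}(A)\to\mathrm{Pic}(B)$, $[I]\mapsto[IB]$, is the canonical map. An overring of $D$ is a ring between $D$ and $K$; it is flat if it is flat as a $D$-module. A Jaffard family of $D$ is a family $\Theta$ of flat overrings of $D$ with $K\notin\Theta$ that is complete ($I=\bigcap_{T\in\Theta}IT$ for every ideal $I$ of $D$), independent ($TT'=K$ for all $T\neq T'$ in $\Theta$) and locally finite (every nonzero $x\in D$ is a non-unit in only finitely many $T\in\Theta$). *)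

(* Defs.v *)
From HB Require Import structures.
From mathcomp Require Import all_boot all_order all_algebra.
From mathcomp Require Import generic_quotient ring_quotient fraction.
From mathcomp Require Import boolp classical_sets functions cardinality.

Set Implicit Arguments.
Unset Strict Implicit.
Unset Printing Implicit Defensive.
Import GRing.Theory.
Local Open Scope classical_set_scope.
Local Open Scope quotient_scope.
Local Open Scope ring_scope.
Local Obligation Tactic := idtac.

(* Domains are handled as subrings of a field: a domain A inside K is an      *)
(* A : subringClosed K, and ideals and fractional ideals are sets in K.       *)
(* Abelian groups, including Picard groups, are zmodTypes, written additively.*)

Definition quotient_field (K : fieldType) (D : subringClosed K) : Prop :=
  forall x : K, exists a b : K, [/\ a \in D, b \in D, b != 0 & x = a / b].

(* The additive span of the products: the ideal product I J, the extension    *)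
(* I T of an ideal to an overring, and the compositum T T' of two overrings.  *)
Definition mulset (L : fieldType) (I J : set L) : set L :=
  [set x | exists s : seq (L * L),
     (forall p, p \in s -> I p.1 /\ J p.2) /\ x = \sum_(p <- s) p.1 * p.2].

Section MulSet.
Variable L : fieldType.
Implicit Types (I J X : set L) (B : subringClosed L).

Definition add_closed X := X 0 /\ forall x y, X x -> X y -> X (x + y).

Lemma mulsetP I J X : add_closed X ->
  (forall x y, I x -> J y -> X (x * y)) -> mulset I J `<=` X.
Proof.
move=> [X0 XD] XM _ [s [sIJ ->]]; elim: s sIJ => [|p s IHs] sIJ.
  by rewrite big_nil.
rewrite big_cons; apply: XD.
  by have [|Ip Jp] := sIJ p; [rewrite mem_head | apply: XM].
by apply: IHs => q qs; apply: sIJ; rewrite inE qs orbT.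
Qed.

Lemma mulset_gen I J x y : I x -> J y -> mulset I J (x * y).
Proof.
move=> Ix Jy; exists [:: (x, y)]; split; last by rewrite big_seq1.
by move=> p; rewrite inE => /eqP ->.
Qed.

Lemma mulset_add I J : add_closed (mulset I J).
Proof.
split; first by exists [::]; split=> //; rewrite big_nil.
move=> _ _ [s [sP ->]] [t [tP ->]]; exists (s ++ t); split.
  by move=> p; rewrite mem_cat => /orP[/sP|/tP].
by rewrite big_cat.
Qed.

Lemma mulsetC I J : mulset I J = mulset J I.
Proof.
by apply/seteqP; split; apply: mulsetP => [|x y Ix Jy];
  try exact: mulset_add; rewrite mulrC; apply: mulset_gen.
Qed.

Lemma mulsetA I J X : mulset I (mulset J X) = mulset (mulset I J) X.
Proof.
apply/seteqP; split; apply: mulsetP; try exact: mulset_add.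
  move=> x y Ix; apply: (mulsetP (X := [set y | mulset (mulset I J) X (x * y)])).
    have [m0 mD] := mulset_add (mulset I J) X.
    by split=> /= [|u v]; rewrite ?mulr0 // mulrDr; apply: mD.
  by move=> u v Ju Xv /=; rewrite mulrA; do 2?apply: mulset_gen.
move=> x y + Xy.
apply: (mulsetP (X := [set x | mulset I (mulset J X) (x * y)])).
  have [m0 mD] := mulset_add I (mulset J X).
  by split=> /= [|u v]; rewrite ?mul0r // mulrDl; apply: mD.
by move=> u v Iu Jv /=; rewrite -mulrA; do 2?apply: mulset_gen.
Qed.

(* No assumption that L is the quotient field of B is needed: the common      *)
(* denominator b forces a fractional ideal to lie inside the quotient field.  *)
Definition submodule B I : Prop :=
  add_closed I /\ forall b x, b \in B -> I x -> I (b * x).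

Definition fractional_ideal B I : Prop :=
  submodule B I /\
  exists b, [/\ b \in B, b != 0 & forall x, I x -> b * x \in B].

Lemma subring_submodule B : submodule B [set` B].
Proof.
split; last by move=> b x; exact: rpredM.
by split=> [|x y]; [exact: rpred0 | exact: rpredD].
Qed.

Lemma subring_fractional B : fractional_ideal B [set` B].
Proof.
split; first exact: subring_submodule.
by exists 1; split=> [||x /=]; rewrite ?rpred1 ?oner_neq0 ?mul1r.
Qed.

Lemma mulset_submodule B X : submodule B (mulset X [set` B]).
Proof.
split; first exact: mulset_add.
have [m0 mD] := mulset_add X [set` B].
move=> b + bB; apply: (mulsetP (X := [set x | mulset X [set` B] (b * x)])).
  by split=> /= [|u v]; rewrite ?mulr0 // mulrDr; apply: mD.
by move=> u v Xu Bv /=; rewrite mulrCA; apply: mulset_gen => //=; apply: rpredM.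
Qed.

Lemma mulset1 B I : submodule B I -> mulset [set` B] I = I.
Proof.
move=> [Iadd IM]; apply/seteqP; split; first exact: mulsetP.
by move=> x Ix; rewrite -(mul1r x); apply: mulset_gen => //=; apply: rpred1.
Qed.

Lemma mulset_fractional B I J :
  fractional_ideal B I -> fractional_ideal B J -> fractional_ideal B (mulset I J).
Proof.
move=> [Isub [b [bB b0 bI]]] [Jsub [c [cB c0 cJ]]]; split.
  by rewrite -(mulset1 Jsub) mulsetA [mulset I _]mulsetC -mulsetA mulsetC;
     exact: mulset_submodule.
exists (b * c); split; rewrite ?rpredM ?mulf_neq0 //.
apply: (mulsetP (X := [set x | b * c * x \in B])).
  by split=> /= [|u v Bu Bv]; rewrite ?mulr0 ?rpred0 // mulrDr rpredD.
by move=> x y Ix Jy /=; rewrite mulrACA rpredM ?bI ?cJ.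
Qed.

Definition scale_set (x : L) I : set L := [set x * y | y in I].

Lemma mulset_scale B x J :
  submodule B J -> mulset (scale_set x [set` B]) J = scale_set x J.
Proof.
move=> [[J0 JD] JM]; apply/seteqP; split.
  apply: mulsetP.
    split; first by exists 0; rewrite ?mulr0.
    by move=> _ _ [u Ju <-] [v Jv <-]; exists (u + v); rewrite ?mulrDr //; apply: JD.
  by move=> _ y [b Bb <-] Jy; exists (b * y); rewrite ?mulrA //; apply: JM.
move=> _ [y Jy <-]; apply: mulset_gen => //; exists 1; rewrite ?mulr1 //.
exact: rpred1.
Qed.

Lemma scale_setA x y I : scale_set x (scale_set y I) = scale_set (x * y) I.
Proof.
apply/seteqP; split=> [_ [_ [z Iz <-] <-]|_ [z Iz <-]].
  by exists z; rewrite // mulrA.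
by exists (y * z); rewrite ?mulrA //; exists z.
Qed.

Lemma scale_set1 I : scale_set 1 I = I.
Proof.
by apply/seteqP; split=> [_ [y Iy <-]|y Iy]; [rewrite mul1r|exists y; rewrite ?mul1r].
Qed.

End MulSet.

Section Picard.
Variables (L : fieldType) (B : subringClosed L).

Record inv_ideal := InvIdeal {
  inv_ideal_set :> set L;
  inv_idealP : fractional_ideal B inv_ideal_set;
  inv_ideal_inv : exists J : set L,
    fractional_ideal B J /\ mulset inv_ideal_set J = [set` B] }.

HB.instance Definition _ := gen_eqMixin inv_ideal.
HB.instance Definition _ := gen_choiceMixin inv_ideal.

Lemma inv_ideal_ext (I J : inv_ideal) : (I : set L) = J -> I = J.
Proof.
case: I J => [I I1 I2] [J J1 J2] /= eIJ; case: _ / eIJ J1 J2 => J1 J2.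
by congr InvIdeal; exact: Prop_irrelevance.
Qed.

Program Definition inv_ideal_one : inv_ideal := @InvIdeal [set` B] _ _.
Next Obligation. exact: subring_fractional. Qed.
Next Obligation.
exists [set` B]; split; first exact: subring_fractional.
exact/mulset1/subring_submodule.
Qed.

Program Definition inv_ideal_mul (I J : inv_ideal) : inv_ideal :=
  @InvIdeal (mulset I J) _ _.
Next Obligation. by move=> I J; apply: mulset_fractional; apply: inv_idealP. Qed.
Next Obligation.
move=> I J; have [I' [fI' eI]] := inv_ideal_inv I.
have [J' [fJ' eJ]] := inv_ideal_inv J.
exists (mulset I' J'); split; first exact: mulset_fractional.
rewrite -mulsetA [mulset J _]mulsetC -mulsetA [mulset J' J]mulsetC eJ.
rewrite mulsetA eI; exact/mulset1/subring_submodule.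
Qed.

Lemma inv_ideal_inverse_exists (I : inv_ideal) :
  exists J : inv_ideal, inv_ideal_mul J I = inv_ideal_one.
Proof.
have [J [fJ eJ]] := inv_ideal_inv I.
have J_inv : exists I' : set L, fractional_ideal B I' /\ mulset J I' = [set` B].
  by exists I; split; [exact: inv_idealP | rewrite mulsetC].
by exists (InvIdeal fJ J_inv); apply: inv_ideal_ext; rewrite /= mulsetC.
Qed.

Definition inv_ideal_inverse (I : inv_ideal) : inv_ideal :=
  projT1 (cid (inv_ideal_inverse_exists I)).

Lemma inv_ideal_mulA : associative inv_ideal_mul.
Proof. by move=> I J X; apply: inv_ideal_ext; exact: mulsetA. Qed.

Lemma inv_ideal_mulC : commutative inv_ideal_mul.
Proof. by move=> I J; apply: inv_ideal_ext; exact: mulsetC. Qed.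

Lemma inv_ideal_mul1 : left_id inv_ideal_one inv_ideal_mul.
Proof. by move=> I; apply: inv_ideal_ext; apply: (mulset1 (proj1 (inv_idealP I))). Qed.

Lemma inv_ideal_mulV : left_inverse inv_ideal_one inv_ideal_inverse inv_ideal_mul.
Proof.
by move=> I; rewrite /inv_ideal_inverse; case: (cid _).
Qed.

HB.instance Definition _ := GRing.isZmodule.Build inv_ideal
  inv_ideal_mulA inv_ideal_mulC inv_ideal_mul1 inv_ideal_mulV.

Definition principal : {pred inv_ideal} := fun I =>
  `[< exists2 x : L, x != 0 & (I : set L) = scale_set x [set` B] >].

Lemma principal_zmod_closed : zmod_closed principal.
Proof.
split=> [|I J /asboolP[x x0 eI] /asboolP[y y0 eJ]]; apply/asboolP.
  by exists 1; rewrite ?oner_neq0 // scale_set1.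
have fN (X : inv_ideal) : submodule B X by case: (inv_idealP X).
have eJN : scale_set y (- J : inv_ideal) = [set` B].
  by rewrite -(mulset_scale y (fN (- J))) -eJ; have /(congr1 inv_ideal_set) := addrN J.
exists (x / y); first by rewrite mulf_neq0 ?invr_eq0.
change (mulset I (- J : inv_ideal) = scale_set (x / y) [set` B]).
by rewrite eI (mulset_scale x (fN (- J))) -eJN scale_setA divfK.
Qed.

HB.instance Definition _ :=
  GRing.isZmodClosed.Build inv_ideal principal principal_zmod_closed.

Definition Pic : zmodType := Quotient.quot principal.

End Picard.

Section LocalPicard.
(* An extension A of B of domains, with ambient fields K and L linked by phi. *)
Variables (K L : fieldType) (phi : {rmorphism K -> L}).
Variables (A : subringClosed K) (B : subringClosed L).
Hypothesis sAB : forall a, a \in A -> phi a \in B.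

Definition ext_set (I : set K) : set L := mulset (phi @` I) [set` B].

Lemma ext_set_mul (I J : set K) :
  ext_set (mulset I J) = mulset (ext_set I) (ext_set J).
Proof.
have -> : mulset (ext_set I) (ext_set J) = mulset (mulset (phi @` I) (phi @` J)) [set` B].
  rewrite /ext_set -mulsetA [mulset [set` B] _]mulsetC -[mulset _ [set` B]]mulsetA.
  by rewrite (mulset1 (subring_submodule B)) mulsetA.
congr (mulset _ _); apply/seteqP; split=> [_ [x IJx <-]|].
  move: x IJx; apply: (mulsetP (X := [set x | mulset (phi @` I) (phi @` J) (phi x)])).
    have [m0 mD] := mulset_add (phi @` I) (phi @` J).
    by split=> /= [|u v]; rewrite ?rmorph0 // rmorphD; apply: mD.
  by move=> x y Ix Jy /=; rewrite rmorphM; apply: mulset_gen; apply: imageP.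
apply: mulsetP => [|_ _ [x Ix <-] [y Jy <-]].
  have [m0 mD] := mulset_add I J; split; first by exists 0; rewrite ?rmorph0.
  by move=> _ _ [u mu <-] [v mv <-]; exists (u + v); rewrite ?rmorphD //; apply: mD.
by exists (x * y); rewrite ?rmorphM //; apply: mulset_gen.
Qed.

Lemma ext_set_scale x :
  ext_set (scale_set x [set` A]) = scale_set (phi x) [set` B].
Proof.
apply/seteqP; split=> [|_ [b Bb <-]]; last first.
  apply: mulset_gen => //; exists x => //; exists 1; rewrite ?mulr1 //.
  exact: rpred1.
apply: mulsetP => [|_ b [_ [a Aa <-] <-] Bb].
  split; first by exists 0; rewrite ?mulr0 //=; apply: rpred0.
  move=> _ _ [u Bu <-] [v Bv <-]; exists (u + v); rewrite ?mulrDr //.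
  exact: (rpredD Bu Bv).
exists (phi a * b); last by rewrite rmorphM mulrA.
exact: (rpredM (sAB Aa) Bb).
Qed.

Lemma ext_set1 : ext_set [set` A] = [set` B].
Proof. by rewrite -(scale_set1 [set` A]) ext_set_scale rmorph1 scale_set1. Qed.

Lemma ext_set_fractional I :
  fractional_ideal A I -> fractional_ideal B (ext_set I).
Proof.
move=> [_ [a [Aa a0 aI]]]; split; first exact: mulset_submodule.
exists (phi a); split; rewrite ?fmorph_eq0 ?sAB //.
apply: (mulsetP (X := [set x | phi a * x \in B])).
  by split=> /= [|u v Bu Bv]; rewrite ?mulr0 ?rpred0 // mulrDr rpredD.
by move=> _ b [x Ix <-] Bb /=; rewrite mulrA -rmorphM rpredM ?sAB ?aI.
Qed.

Program Definition ext_ideal (I : inv_ideal A) : inv_ideal B :=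
  @InvIdeal _ B (ext_set I) _ _.
Next Obligation. by move=> I; apply/ext_set_fractional/inv_idealP. Qed.
Next Obligation.
move=> I; have [J [fJ eJ]] := inv_ideal_inv I.
exists (ext_set J); split; first exact: ext_set_fractional.
by rewrite -ext_set_mul eJ ext_set1.
Qed.

Lemma ext_ideal_is_additive : zmod_morphism ext_ideal.
Proof.
have extD I J : ext_ideal (I + J) = ext_ideal I + ext_ideal J.
  by apply: inv_ideal_ext; apply: ext_set_mul.
by move=> I J; apply/eqP; rewrite eq_sym subr_eq -extD subrK.
Qed.

HB.instance Definition _ := GRing.isZmodMorphism.Build
  (inv_ideal A) (inv_ideal B) ext_ideal ext_ideal_is_additive.

Definition Pic_ext (c : Pic A) : Pic B := \pi_(Pic B) (ext_ideal (repr c)).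

Lemma Pic_ext_pi (I : inv_ideal A) : Pic_ext (\pi_(Pic A) I) = \pi_(Pic B) (ext_ideal I).
Proof.
apply/eqP; rewrite /Pic_ext -Quotient.idealrBE -raddfB /=.
have : \pi_(Pic A) (repr (\pi_(Pic A) I)) == \pi_(Pic A) I by rewrite reprK.
rewrite -Quotient.idealrBE => /asboolP[x x0 eI]; apply/asboolP; exists (phi x).
  by rewrite fmorph_eq0.
exact: (eq_trans (congr1 ext_set eI) (ext_set_scale x)).
Qed.

Lemma Pic_ext_is_additive : zmod_morphism Pic_ext.
Proof.
move=> a b; rewrite -[a]reprK -[b]reprK -[X in Pic_ext X]raddfB !Pic_ext_pi.
by rewrite !raddfB.
Qed.

HB.instance Definition _ := GRing.isZmodMorphism.Build
  (Pic A) (Pic B) Pic_ext Pic_ext_is_additive.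

Definition Pic_ext_image : {pred Pic B} := fun c => `[< exists a, c = Pic_ext a >].

Lemma Pic_ext_image_zmod_closed : zmod_closed Pic_ext_image.
Proof.
split=> [|_ _ /asboolP[a ->] /asboolP[b ->]]; apply/asboolP.
  by exists 0; rewrite raddf0.
by exists (a - b); rewrite raddfB.
Qed.

HB.instance Definition _ :=
  GRing.isZmodClosed.Build (Pic B) Pic_ext_image Pic_ext_image_zmod_closed.

Definition LPic : zmodType := Quotient.quot Pic_ext_image.

End LocalPicard.

Section IntegerValued.
Variables (K : fieldType) (E : set K) (A : subringClosed K).

Definition Int_poly : {pred {poly K}} := fun f =>
  `[< forall x, E x -> f.[x] \in A >].

(* Int(E, A), viewed inside the field K(X) of rational functions.             *)
Definition Int_frac : {pred {fraction {poly K}}} := fun y =>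
  `[< exists2 f, f \in Int_poly & y = tofrac f >].

Lemma Int_frac_subring_closed : subring_closed Int_frac.
Proof.
split; first (apply/asboolP; exists 1; last by rewrite rmorph1).
- by apply/asboolP=> x _; rewrite hornerC rpred1.
- move=> _ _ /asboolP[f /asboolP Ef ->] /asboolP[g /asboolP Eg ->].
  apply/asboolP; exists (f - g); last by rewrite rmorphB.
  by apply/asboolP=> x Ex; rewrite !hornerE rpredB ?Ef ?Eg.
- move=> _ _ /asboolP[f /asboolP Ef ->] /asboolP[g /asboolP Eg ->].
  apply/asboolP; exists (f * g); last by rewrite rmorphM.
  by apply/asboolP=> x Ex; rewrite !hornerE rpredM ?Ef ?Eg.
Qed.

HB.instance Definition _ := GRing.isSubringClosed.Build
  {fraction {poly K}} Int_frac Int_frac_subring_closed.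

Definition Int : subringClosed {fraction {poly K}} := Int_frac.

Definition const_frac : {rmorphism K -> {fraction {poly K}}} :=
  @tofrac {poly K} \o polyC.

Lemma const_Int (a : K) : a \in A -> const_frac a \in Int.
Proof.
move=> Aa; apply/asboolP; exists a%:P => //.
by apply/asboolP=> x _; rewrite hornerC.
Qed.

Definition LPicInt : zmodType := LPic const_Int.

End IntegerValued.

Section Flatness.
Variable R : comNzRingType.

Definition balanced (M N : lmodType R) (P : zmodType) (b : M -> N -> P) : Prop :=
  [/\ forall m m' n, b (m + m') n = b m n + b m' n,
      forall m n n', b m (n + n') = b m n + b m n' &
      forall r m n, b (r *: m) n = b m (r *: n)].

(* A list of pairs (m, n) stands for the sum of the tensors m (x) n; every    *)
(* element of the tensor product is of this form, and by the universal        *)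
(* property two sums are equal iff no balanced map separates them.            *)
Definition tensor_equiv (M N : lmodType R) (s t : seq (M * N)) : bool :=
  `[< forall (P : zmodType) (b : M -> N -> P), balanced b ->
        \sum_(p <- s) b p.1 p.2 = \sum_(p <- t) b p.1 p.2 >].

Lemma tensor_equiv_is_equiv (M N : lmodType R) :
  equiv_class_of (@tensor_equiv M N).
Proof.
split=> [s|s t|t s u]; first by apply/asboolP.
  by apply/asboolP/asboolP=> H P b bb; rewrite H.
by move=> /asboolP H1 /asboolP H2; apply/asboolP=> P b bb; rewrite H1 ?H2.
Qed.

Canonical tensor_equiv_rel (M N : lmodType R) :=
  EquivRelPack (@tensor_equiv_is_equiv M N).
Canonical tensor_equiv_encModRel (M N : lmodType R) :=
  defaultEncModRel (@tensor_equiv M N).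

Definition tensor (M N : lmodType R) := {eq_quot (@tensor_equiv M N)}.

Definition tensor_map (M M' N : lmodType R) (f : {linear M -> M'})
    (c : tensor M N) : tensor M' N :=
  \pi_(tensor M' N) [seq (f p.1, p.2) | p <- repr c].

Lemma tensor_map_pi (M M' N : lmodType R) (f : {linear M -> M'}) (s : seq (M * N)) :
  tensor_map f (\pi_(tensor M N) s) =
  \pi_(tensor M' N) [seq (f p.1, p.2) | p <- s].
Proof.
apply/eqmodP/asboolP=> P b [bl br bb]; rewrite !big_map /=.
have /eqmodP/asboolP H : repr (\pi_(tensor M N) s) = s %[mod tensor M N].
  by rewrite reprK.
apply: (H P (fun m n => b (f m) n)); split=> [m m' n|m n n'|r m n].
- by rewrite raddfD bl.
- by rewrite br.
- by rewrite linearZ bb.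
Qed.

Definition flat (V : lmodType R) : Prop :=
  forall (M M' : lmodType R) (f : {linear M -> M'}),
    injective f -> injective (@tensor_map M M' V f).

End Flatness.

Section SubringType.
Variables (K : fieldType) (D : subringClosed K).

Record subring_type := SubringType {
  subring_val :> K; subring_valP : subring_val \in D }.

HB.instance Definition _ := [isSub for subring_val].
HB.instance Definition _ := [Choice of subring_type by <:].
HB.instance Definition _ := [SubChoice_isSubComNzRing of subring_type by <:].

End SubringType.

(* Every ring between D and K, K being understood as the quotient field of D. *)
Record overring (K : fieldType) (D : subringClosed K) := Overring {
  overring_ring :> subringClosed K;
  overring_sub : forall x : K, x \in D -> x \in overring_ring }.

Section OverringModule.
Variables (K : fieldType) (D : subringClosed K) (T : overring D).

Definition overring_mod := subring_type T.
HB.instance Definition _ := GRing.Zmodule.on overring_mod.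

Definition overring_scale (d : subring_type D) (t : overring_mod) : overring_mod :=
  SubringType (rpredM (overring_sub T (subring_valP d)) (subring_valP t)).

Fact overring_scaleA a b v :
  overring_scale a (overring_scale b v) = overring_scale (a * b) v.
Proof. by apply: val_inj; rewrite /= mulrA. Qed.
Fact overring_scale1 : left_id 1 overring_scale.
Proof. by move=> v; apply: val_inj; rewrite /= mul1r. Qed.
Fact overring_scaleDr : right_distributive overring_scale +%R.
Proof. by move=> a u v; apply: val_inj; rewrite /= mulrDr. Qed.
Fact overring_scaleDl v : {morph overring_scale^~ v : a b / a + b}.
Proof. by move=> a b; apply: val_inj; rewrite /= mulrDl. Qed.

HB.instance Definition _ := GRing.Zmodule_isLmodule.Build (subring_type D)
  overring_mod overring_scaleA overring_scale1 overring_scaleDr overring_scaleDl.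

End OverringModule.

Section Jaffard.
Variables (K : fieldType) (D : subringClosed K).

Lemma subringClosed_ext (A B : subringClosed K) : A =i B -> A = B.
Proof.
case: A B => [A cA] [B cB] e0.
have e : A = B by apply/funext => x; exact: e0.
case: _ / e cB {e0} => cB; congr (GRing.SubringClosed.Pack _).
case: cA cB => [[a1] [a2] [a3] [a4]] [[b1] [b2] [b3] [b4]].
by rewrite (Prop_irrelevance a1 b1) (Prop_irrelevance a2 b2)
  (Prop_irrelevance a3 b3) (Prop_irrelevance a4 b4).
Qed.

Lemma overring_ext (T T' : overring D) : T =i T' -> T = T'.
Proof.
case: T T' => [T sT] [T' sT'] e0; have {e0} e : T = T' := subringClosed_ext e0.
by case: _ / e sT' => sT'; congr Overring; exact: Prop_irrelevance.
Qed.

Definition ideal (I : set K) : Prop := submodule D I /\ I `<=` [set` D].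

Definition unit_in (T : subringClosed K) (x : K) : Prop :=
  x \in T /\ exists2 y, y \in T & x * y = 1.

Definition jaffard_family (Theta : set (overring D)) : Prop :=
  [/\ forall T, Theta T -> flat (overring_mod T),
      forall T, Theta T -> [set` T] <> [set: K],
      forall I, ideal I -> I = \bigcap_(T in Theta) mulset I [set` T],
      forall T T', Theta T -> Theta T' -> T <> T' ->
        mulset [set` T] [set` T'] = [set: K] &
      forall x, x \in D -> x != 0 ->
        finite_set [set T | Theta T /\ ~ unit_in T x]].

End Jaffard.

Section DirectSum.
Variables (I : Type) (G : I -> zmodType).

Record direct_sum := DirectSum {
  direct_sum_fun :> forall i, G i;
  direct_sum_finite : finite_set [set i | direct_sum_fun i != 0] }.

HB.instance Definition _ := gen_eqMixin direct_sum.
HB.instance Definition _ := gen_choiceMixin direct_sum.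

Lemma direct_sum_ext (f g : direct_sum) : (forall i, f i = g i) -> f = g.
Proof.
case: f g => [f f1] [g g1] /= e0.
have {e0} e : f = g := functional_extensionality_dep e0.
by case: _ / e g1 => g1; congr DirectSum; exact: Prop_irrelevance.
Qed.

Program Definition direct_sum_zero : direct_sum := @DirectSum (fun=> 0) _.
Next Obligation. by rewrite (_ : [set _ | _] = set0) // -subset0 => i /=; rewrite eqxx. Qed.

Program Definition direct_sum_opp (f : direct_sum) : direct_sum :=
  @DirectSum (fun i => - f i) _.
Next Obligation.
by move=> f; apply: sub_finite_set (direct_sum_finite f) => i /=; rewrite oppr_eq0.
Qed.

Program Definition direct_sum_add (f g : direct_sum) : direct_sum :=
  @DirectSum (fun i => f i + g i) _.
Next Obligation.
move=> f g.
apply: (sub_finite_set (B := [set i | f i != 0] `|` [set i | g i != 0])).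
  move=> i /= nz; have [fi0|] := eqVneq (f i) 0; last by left.
  by right; move: nz; rewrite fi0 add0r.
by rewrite finite_setU; split; apply: direct_sum_finite.
Qed.

Fact direct_sum_addA : associative direct_sum_add.
Proof. by move=> f g h; apply: direct_sum_ext => i /=; rewrite addrA. Qed.
Fact direct_sum_addC : commutative direct_sum_add.
Proof. by move=> f g; apply: direct_sum_ext => i /=; rewrite addrC. Qed.
Fact direct_sum_add0 : left_id direct_sum_zero direct_sum_add.
Proof. by move=> f; apply: direct_sum_ext => i /=; rewrite add0r. Qed.
Fact direct_sum_addN : left_inverse direct_sum_zero direct_sum_opp direct_sum_add.
Proof. by move=> f; apply: direct_sum_ext => i /=; rewrite addNr. Qed.

HB.instance Definition _ := GRing.isZmodule.Build direct_sum
  direct_sum_addA direct_sum_addC direct_sum_add0 direct_sum_addN.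

End DirectSum.

Definition isomorphic (G H : zmodType) : Prop :=
  exists f : {additive G -> H}, bijective f.

(* Main.v *)
(* Write B = Int(E, D) and B_T = Int(E, T). An invertible ideal of B or B_T    *)
(* becomes principal over the PID K[X]; dividing by a generator makes it       *)
(* commensurable with the ring: it contains a nonzero c of D and is carried    *)
(* into the ring by c. Such an I satisfies I B_T = B_T for every T in which c  *)
(* is a unit, so by local finiteness I |-> (I B_T)_T lands in the direct sum.  *)
(* Completeness and independence give, for c <> 0 and T in Theta, an element p *)
(* of D with p in c S for all S <> T and 1 - p in c T. If c x lies in all I_S  *)
(* and x in I_T, then x = p x + ((1 - p) / c) (c x) with p x and c x in the    *)
(* intersection of the I_S. Hence a family of invertible ideals with uniform c *)
(* is glued to an invertible ideal by intersecting it: over B this gives       *)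
(* surjectivity, and over D, after observing that a generator x_T in K(X) of a *)
(* commensurable ideal x_T J_T B_T must be a constant, it gives injectivity.   *)
(* The same p shows that D is c-adically dense in T, so Int(D, T) = Int(T, T). *)

(* Both groups are quotients of the group of invertible ideals of B: [lpic_class] maps it onto
   LPic(B, D), and [local_classes], which sends I to the classes of the I B_T, maps it to the direct
   sum of the LPic(B_T, T). By [factor_map_isomorphic] it suffices that [local_classes] is onto and
   has the same kernel as [lpic_class].

   The engine is the approximation lemma [jaffard_separate], drawn from flatness ([flat_den]),
   independence ([jaffard_escape]), completeness ([jaffard_comaximal]) and local finiteness. It
   yields that B-modules are determined by their extensions to the B_T ([eq_of_local_ext]) and that
   invertible ideals with a uniform bound glue ([glue_inv_ideal]); the bounds come from
   [inv_ideal_normalize]. Gluing over B gives surjectivity ([local_classes_surj]). If all classes of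
   a normalized ideal vanish, each of its extensions comes from an ideal of T without any scaling
   ([local_ideal]), and gluing these over D settles the kernel ([ker_local_classes]). The statement
   on Int(D) is the case E = D, by [Int_poly_jaffard]. *)
From HB Require Import structures.
Require Import Defs.
From mathcomp Require Import all_boot all_algebra.
From mathcomp Require Import generic_quotient ring_quotient fraction.
From mathcomp Require Import boolp classical_sets functions cardinality.

Set Implicit Arguments.
Unset Strict Implicit.
Unset Printing Implicit Defensive.
Import GRing.Theory.
Local Open Scope classical_set_scope.
Local Open Scope quotient_scope.
Local Open Scope ring_scope.

(** * Flat overrings *)

Section FlatDenominators.
Variables (K : fieldType) (D : subringClosed K) (T : overring D).
Local Notation R := (subring_type D).

Section TwoGenerated.
Variables a b : R.

Definition two_gen : {pred R^o} := fun m => `[< exists x y : R, m = (x * a + y * b : R) >].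

Lemma two_gen_submod_closed : submod_closed two_gen.
Proof.
split; first by apply/asboolP; exists 0, 0; rewrite !mul0r addr0.
move=> c _ _ /asboolP[x [y ->]] /asboolP[x' [y' ->]]; apply/asboolP.
exists (c * x + x'), (c * y + y').
by rewrite [LHS](_ : _ = c * (x * a + y * b) + (x' * a + y' * b) :> R) //
  mulrDr !mulrDl !mulrA addrACA.
Qed.

HB.instance Definition _ :=
  GRing.isSubmodClosed.Build R R^o two_gen (GRing.submod_closed_semi two_gen_submod_closed).

Record two_gen_type := TwoGen { two_gen_val :> R^o; two_gen_valP : two_gen_val \in two_gen }.
HB.instance Definition _ := [isSub for two_gen_val].
HB.instance Definition _ := [Choice of two_gen_type by <:].
HB.instance Definition _ := [SubChoice_isSubLmodule of two_gen_type by <:].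

End TwoGenerated.

Section IdealMultiple.
Variable I : set K.

Definition ideal_mult : {pred overring_mod T} :=
  fun t => `[< mulset I [set` T] (subring_val t) >].

Lemma ideal_mult_zmod_closed : zmod_closed ideal_mult.
Proof.
have [m0 mD] := mulset_add I [set` T].
have [_ mM] := mulset_submodule T I.
split=> [|x y /asboolP Ix /asboolP Iy]; apply/asboolP; first exact: m0.
rewrite [subring_val _]/(subring_val x - subring_val y).
by apply: mD => //; rewrite -mulN1r; apply: mM => //; rewrite rpredN rpred1.
Qed.

HB.instance Definition _ :=
  GRing.isZmodClosed.Build (overring_mod T) ideal_mult ideal_mult_zmod_closed.

End IdealMultiple.

(* Let M be the ideal (a, b) of D. As M (x) T injects into D (x) T, the relation *)
(* b t = a already holds in M (x) T as a (x) 1 = b (x) t; the balanced map       *)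
(* (x a + y b, n) |-> x n mod I T, with I = (b D : a), turns it into 1 = 0.      *)
Lemma flat_colon (a b : R) (t one : overring_mod T) : flat (overring_mod T) ->
  subring_val one = 1 -> b *: t = a *: one ->
  mulset [set d | exists e x : R, d = subring_val e /\ e * a = x * b] [set` T] 1.
Proof.
move=> Tflat one1 ebt; set I := [set d | _].
pose M : lmodType R := two_gen_type a b.
have Ma : (a : R^o) \in two_gen a b.
  by apply/asboolP; exists 1, 0; rewrite mul1r mul0r addr0.
have Mb : (b : R^o) \in two_gen a b.
  by apply/asboolP; exists 0, 1; rewrite mul1r mul0r add0r.
pose ma := TwoGen Ma; pose mb := TwoGen Mb.
pose f : {linear M -> R^o} := val.
have : tensor_map f (\pi_(tensor M (overring_mod T)) [:: (ma, one)])
     = tensor_map f (\pi_(tensor M (overring_mod T)) [:: (mb, t)]).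
  rewrite !tensor_map_pi; apply/eqmodP/asboolP => P g [_ _ gb].
  rewrite !big_seq1 /=.
  have sc (c : R) n : g (c : R^o) n = g (1 : R^o) (c *: n).
    by rewrite -gb; congr (g _ n); rewrite [RHS]mulr1.
  by rewrite [LHS]sc [RHS]sc ebt.
move=> /(Tflat _ _ f val_inj) /eqmodP/asboolP.
pose Q := Quotient.quot (ideal_mult I).
have coefP (m : two_gen_type a b) :
    exists x : R, exists y : R, (two_gen_val m : R) = x * a + y * b.
  by have /asboolP := two_gen_valP m.
pose coef (m : two_gen_type a b) := projT1 (cid (coefP m)).
(* The coefficient of a is well defined modulo I: if x' a + y' b = x a + y b, then (x' - x) a = (y -
   y') b, so x' - x lies in (b D : a). *)
have coefE (m : two_gen_type a b) (x y : R) n : (two_gen_val m : R) = x * a + y * b ->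
    \pi_Q (coef m *: n) = \pi_Q (x *: n).
  rewrite /coef; case: cid => x' /= [y' ->] e.
  apply/eqP; rewrite -Quotient.idealrBE -scalerBl; apply/asboolP.
  apply: mulset_gen; last exact: subring_valP.
  exists (x' - x), (y - y'); split=> //.
  by apply/eqP; rewrite !mulrBl subr_eq addrAC eq_sym subr_eq [X in _ == X]e addrC.
move=> /(_ Q (fun m n => \pi_Q (coef m *: n))); rewrite !big_seq1 /=.
have -> : \pi_Q (coef ma *: one) = \pi_Q (1 *: one).
  by apply: (coefE _ _ 0); rewrite mul1r mul0r addr0.
have -> : \pi_Q (coef mb *: t) = \pi_Q (0 *: t).
  by apply: (coefE _ _ 1); rewrite mul1r mul0r add0r.
rewrite scale1r scale0r => e.
have /e/eqP : balanced (fun m n => \pi_Q (coef m *: n)).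
  split=> [m m' n|m n n'|r m n].
  - have [x [y em]] := coefP m; have [x' [y' em']] := coefP m'.
    rewrite (coefE _ (x + x') (y + y')) ?(coefE m x y) ?(coefE m' x' y') //.
      by rewrite scalerDl raddfD.
    by rewrite [LHS](_ : _ = (two_gen_val m : R) + (two_gen_val m' : R)) //
      em em' !mulrDl addrACA.
  - by rewrite scalerDr raddfD.
  - have [x [y em]] := coefP m.
    rewrite (coefE _ (r * x) (r * y)) ?(coefE m x y) ?scalerA //; first by rewrite mulrC.
    by rewrite [LHS](_ : _ = r * (two_gen_val m : R)) // em mulrDr !mulrA.
by rewrite -Quotient.idealrBE subr0 => /asboolP; rewrite one1.
Qed.

(** For t = a / b the conductor (D :_D t) is the ideal (b D : a) of [flat_colon]. *)
Lemma flat_den t : quotient_field D -> flat (overring_mod T) -> t \in T ->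
  mulset [set d | d \in D /\ d * t \in D] [set` T] 1.
Proof.
move=> hK Tflat Tt; have [a [b [Da Db b0 et]]] := hK t.
have := @flat_colon (SubringType Da) (SubringType Db) (SubringType Tt)
    (SubringType (rpred1 T)) Tflat (erefl 1).
have -> : [set d | d \in D /\ d * t \in D] =
  [set d | exists e x : R, d = subring_val e /\ e * SubringType Da = x * SubringType Db].
  apply/seteqP; split=> [d [Dd Ddt]|_ [e [x [-> /(congr1 (@subring_val _ _)) /= exa]]]] /=.
    exists (SubringType Dd), (SubringType Ddt); split=> //.
    by apply: val_inj; rewrite /= et mulrA divfK.
  split; first exact: subring_valP.
  by rewrite et mulrA exa mulfK // subring_valP.
by apply; apply: val_inj; rewrite /= et mulr1 mulrC divfK.
Qed.

End FlatDenominators.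

(** * Jaffard families *)

Section Mulset.
Variable L : fieldType.
Implicit Types (I J X : set L) (B : subringClosed L).

Lemma mulsetS I I' J J' : I `<=` I' -> J `<=` J' -> mulset I J `<=` mulset I' J'.
Proof.
move=> II' JJ'; apply: mulsetP; first exact: mulset_add.
by move=> x y /II' Ix /JJ' Jy; apply: mulset_gen.
Qed.

Lemma mulset_subring I B : submodule B I -> mulset I [set` B] = I.
Proof. by move=> Isub; rewrite mulsetC mulset1. Qed.

Lemma mulset_mulset_subring I J B :
  mulset (mulset I [set` B]) (mulset J [set` B]) = mulset (mulset I J) [set` B].
Proof.
rewrite -mulsetA [mulset [set` B] _]mulsetC -[mulset _ [set` B]]mulsetA.
by rewrite (mulset1 (subring_submodule B)) mulsetA.
Qed.

Lemma subring_add_closed B : add_closed [set` B].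
Proof. by case: (subring_submodule B). Qed.

End Mulset.

Lemma finite_set_ind (I : Type) (P : set I -> Prop) :
  P set0 -> (forall i S, P S -> P (i |` S)) -> forall S, finite_set S -> P S.
Proof.
move=> P0 PU S /(@finite_seqP {classic I})[s ->].
elim: s => [|i s IHs]; first by rewrite classical_sets.set_nil.
rewrite (_ : [set` i :: s] = i |` [set` s]); first exact: PU.
apply/seteqP; split=> j /=; rewrite in_cons; first by move=> /orP[/eqP|]; [left|right].
by move=> [->|->]; rewrite ?eqxx ?orbT.
Qed.

Section FiniteChoice.
Variables (K : fieldType) (D : subringClosed K) (I : Type) (S : set I).
Variable P : I -> K -> Prop.
Hypothesis PM : forall i c d, d \in D -> d != 0 -> P i c -> P i (d * c).

(** Turns commensurability constants chosen for finitely many overrings into a uniform one. *)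
Lemma finite_common_multiple : finite_set S ->
  (forall i, S i -> exists c, [/\ c \in D, c != 0 & P i c]) ->
  exists c, [/\ c \in D, c != 0 & forall i, S i -> P i c].
Proof.
move=> Sfin; elim/finite_set_ind: S / Sfin => [|i U IHU] HP.
  by exists 1; rewrite rpred1 oner_neq0; split.
have [|c [Dc c0 Pc]] := IHU; first by move=> j Uj; apply: HP; right.
have [|d [Dd d0 Pd]] := HP i; first by left.
exists (d * c); split; rewrite ?rpredM ?mulf_neq0 // => j [->|/Pc]; last exact: PM.
by rewrite mulrC; apply: PM.
Qed.

End FiniteChoice.

(* For x in L and T flat, x lies in the T-span of M iff 1 lies in (M :_D x) T, *)
(* so that membership in M can be tested on ideals of D alone.                 *)
Section Denominators.
Variables (K L : fieldType) (phi : {rmorphism K -> L}) (D : subringClosed K).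
Implicit Types (M : set L) (x y : L) (T : overring D).

Definition denominators M x : set K := [set d | d \in D /\ M (phi d * x)].

Definition scalable_by (A : subringClosed K) M : Prop :=
  forall a x, a \in A -> M x -> M (phi a * x).

Lemma denominators_submodule M x :
  add_closed M -> scalable_by D M -> submodule D (denominators M x).
Proof.
move=> [M0 MD] MZ; split; first split=> [|d e [Dd Md] [De Me]].
- by rewrite /denominators /= rpred0 rmorph0 mul0r.
- by split; rewrite ?rpredD // rmorphD mulrDl; apply: MD.
- by move=> d e Dd [De Me]; split; rewrite ?rpredM // rmorphM -mulrA; apply: MZ.
Qed.

(** The product (M :_D x) (M :_D y) lies in (M :_D x + y). This reduces the test on a span to its
    generators. *)
Lemma denominators_add_closed M T : add_closed M -> scalable_by D M ->
  add_closed [set x | mulset (denominators M x) [set` T] 1].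
Proof.
move=> Madd MZ; have [M0 MD] := Madd; split=> [|x y /= Hx Hy].
  have := @mulset_gen _ (denominators M 0) [set` T] 1 1; rewrite mulr1; apply.
    by split; rewrite ?rpred1 ?mulr0.
  exact: rpred1.
have := mulset_gen Hx Hy; rewrite mulr1 mulset_mulset_subring.
apply: mulsetS => //; apply: mulsetP.
  by case: (denominators_submodule (x + y) Madd MZ).
move=> d e [Dd Md] [De Me]; split; first exact: rpredM.
rewrite mulrDr; apply: MD; last by rewrite rmorphM -mulrA; apply: MZ.
by rewrite [d * e]mulrC rmorphM -mulrA; apply: MZ.
Qed.

Lemma flat_denominators M T x t : quotient_field D -> flat (overring_mod T) ->
  scalable_by D M -> M x -> t \in T ->
  mulset (denominators M (phi t * x)) [set` T] 1.
Proof.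
move=> hK Tflat MZ Mx Tt; apply: mulsetS (flat_den hK Tflat Tt) => // d [Dd Ddt].
by split=> //; rewrite mulrA -rmorphM; apply: MZ.
Qed.

End Denominators.

Section Jaffard.
Variables (K : fieldType) (D : subringClosed K) (Theta : set (overring D)).
Hypotheses (hK : quotient_field D) (hTheta : jaffard_family Theta).
Implicit Types (S T : overring D) (c : K).

Lemma jaffard_flat T : Theta T -> flat (overring_mod T).
Proof. by case: hTheta => + _ _ _ _; apply. Qed.

Lemma jaffard_complete I x : ideal D I ->
  (forall T, Theta T -> mulset I [set` T] x) -> I x.
Proof. by case: hTheta => _ _ H _ _ Iid Ix; rewrite (H I Iid) => T /Ix. Qed.

Lemma jaffard_overring_cap x : (forall T, Theta T -> x \in T) -> x \in D.
Proof.
move=> xT; have Did : ideal D [set` D] by split=> //; exact: subring_submodule.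
apply: (jaffard_complete Did) => T /xT Tx.
by rewrite -(mul1r x); apply: mulset_gen => //; apply: rpred1.
Qed.

(** Completeness concerns ideals of D alone; applied to (M :_D x), which contains 1 exactly when x
    is in M, it reaches all D-submodules of L. *)
Lemma local_mem (L : fieldType) (phi : {rmorphism K -> L}) (M : set L) x :
  add_closed M -> scalable_by phi D M ->
  (forall T, Theta T -> mulset (denominators phi D M x) [set` T] 1) -> M x.
Proof.
move=> Madd MZ Hx; suff [_] : denominators phi D M x 1 by rewrite rmorph1 mul1r.
apply: jaffard_complete Hx; split; first exact: denominators_submodule.
by move=> d [].
Qed.

(** By independence c^-1 is a sum of products s t. Flatness of T gives 1 in (S :_D s t) T for each
    of them, hence 1 in (S :_D c^-1) T. *)
Lemma jaffard_escape S T c : Theta S -> Theta T -> S <> T -> c != 0 ->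
  mulset [set q | q \in D /\ q / c \in S] [set` T] 1.
Proof.
move=> ThS ThT neq c0; case: (hTheta) => _ _ _ indep _.
have Sadd := subring_add_closed S.
have SZ : scalable_by idfun D [set` S].
  by move=> a x Da Sx; apply: rpredM => //; apply: overring_sub.
have : mulset [set` S] [set` T] c^-1 by rewrite indep.
move=> ST; apply: (mulsetP (X := [set x | mulset (denominators idfun D [set` S] x) _ 1])) ST.
  exact: denominators_add_closed.
move=> s t Ss Tt; rewrite /= mulrC.
by apply: (flat_denominators (phi := idfun)) => //; apply: jaffard_flat.
Qed.

Lemma jaffard_comaximal S T c : Theta S -> Theta T -> S <> T -> c != 0 ->
  exists q, [/\ q \in D, q / c \in S & (1 - q) / c \in T].
Proof.
move=> ThS ThT neq c0.
pose J (U : overring D) := [set q | q \in D /\ q / c \in U].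
have J0 U : J U 0 by split; rewrite ?mul0r rpred0.
have JD U x y : J U x -> J U y -> J U (x + y).
  by move=> [Dx Ux] [Dy Uy]; split; rewrite ?mulrDl; apply: rpredD.
have JM U d x : d \in D -> J U x -> J U (d * x).
  move=> Dd [Dx Ux]; split; rewrite -?mulrA; first exact: rpredM.
  by apply: rpredM => //; apply: overring_sub.
pose I := [set x | exists q r, [/\ J S q, J T r & x = q + r]].
have Iid : ideal D I.
  split; last by move=> _ [q [r [[Dq _] [Dr _] ->]]]; apply: rpredD.
  split; first split.
  - by exists 0, 0; rewrite addr0.
  - move=> _ _ [q [r [Sq Tr ->]]] [q' [r' [Sq' Tr' ->]]].
    by exists (q + q'), (r + r'); rewrite addrACA; split=> //; apply: JD.
  - move=> d _ Dd [q [r [Sq Tr ->]]].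
    by exists (d * q), (d * r); rewrite mulrDr; split=> //; apply: JM.
have [q [r [[Dq Sq] [Dr Tr] e]]] : I 1.
  (* [I] is checked to be the unit ideal locally: at [U = S] the summand [J T] already extends to
     [U], elsewhere [J S] does. *)
  apply: jaffard_complete Iid _ => U ThU; have [eUS|neUS] := pselect (S = U).
    apply: mulsetS (jaffard_escape ThT ThU _ c0) => //; last by rewrite -eUS => /esym.
    by move=> r Jr; exists 0, r; split; rewrite ?add0r.
  apply: mulsetS (jaffard_escape ThS ThU neUS c0) => //.
  by move=> q Jq; exists q, 0; split; rewrite ?addr0.
by exists q; split=> //; rewrite e addrAC subrr add0r.
Qed.

(** Where c is a unit of S the condition at S is automatic. For the finitely many other S, the
    elements given by [jaffard_comaximal] are multiplied; all are congruent to 1 modulo c T. *)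
Lemma jaffard_separate T c : Theta T -> c \in D -> c != 0 ->
  exists p, [/\ p \in D, (1 - p) / c \in T &
    forall S, Theta S -> S <> T -> p / c \in S].
Proof.
move=> ThT Dc c0; case: (hTheta) => _ _ _ _ /(_ c Dc c0).
set N := [set S | _] => Nfin.
have unit_case S : Theta S -> ~ N S -> c^-1 \in S.
  move=> ThS NS; have [_ [y Sy cy1]] : unit_in S c by apply: contrapT => nu; apply: NS.
  by rewrite -[c^-1]mulr1 -cy1 mulKf.
have [p [Dp Tp Sp]] : exists p, [/\ p \in D, (1 - p) / c \in T &
    forall S, Theta S -> S <> T -> N S -> p / c \in S].
  clear unit_case; elim/finite_set_ind: N / Nfin => [|S N [p [Dp Tp Sp]]].
    by exists 1; rewrite rpred1 subrr mul0r rpred0; split.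
  have [[ThS neq]|nS] := pselect (Theta S /\ S <> T).
    have [q [Dq Sq Tq]] := jaffard_comaximal ThS ThT neq c0.
    exists (p * q); split; first exact: rpredM.
      have -> : (1 - p * q) / c = (1 - p) / c + p * ((1 - q) / c).
        by rewrite mulrA -mulrDl mulrBr mulr1 addrA subrK.
      by apply: rpredD => //; apply: rpredM => //; apply: overring_sub.
    move=> U ThU neU [->|NU].
      by rewrite -mulrA; apply: rpredM => //; apply: overring_sub.
    by rewrite mulrAC; apply: rpredM; [apply: Sp|apply: overring_sub].
  exists p; split=> // U ThU neU [eU|]; last exact: Sp.
  by case: nS; rewrite -eU.
exists p; split=> // S ThS neS; have [|NS] := pselect (N S); first exact: Sp.
by apply: rpredM; [apply: overring_sub|apply: unit_case].
Qed.

End Jaffard.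

(** * Approximation and gluing of elements *)

Section Gluing.
Variables (K : fieldType) (D : subringClosed K) (Theta : set (overring D)).
Hypotheses (hK : quotient_field D) (hTheta : jaffard_family Theta).
Implicit Types (S T : overring D) (c : K).

Lemma jaffard_dense T t c : Theta T -> t \in T -> c \in D -> c != 0 ->
  exists d, d \in D /\ (t - d) / c \in T.
Proof.
move=> ThT Tt Dc c0; have [a [b [Da Db b0 et]]] := hK t.
(* The modulus is b c rather than c, so that the extra factor b clears the denominator of t in p
   t. *)
have bc0 : b * c != 0 by rewrite mulf_neq0.
have [p [Dp Tp Sp]] := jaffard_separate hK hTheta ThT (rpredM Db Dc) bc0.
exists (p * t); split.
  apply: (jaffard_overring_cap hTheta) => S ThS; have [->|neq] := pselect (S = T).
    by apply: rpredM => //; apply: overring_sub.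
  have -> : p * t = p / (b * c) * (a * c) 
    by rewrite et [RHS]mulrAC -[RHS]mulrA -mulf_div divff // mulr1.
  by apply: rpredM; [apply: Sp|apply: overring_sub; apply: rpredM].
have -> : (t - p * t) / c = (1 - p) / (b * c) * a 
  by rewrite -[X in X - _]mul1r -mulrBl et [RHS]mulrAC -[RHS]mulrA
    -mulrA invfM [a * (_ * _)]mulrA.
by apply: rpredM => //; apply: overring_sub.
Qed.

Lemma polyOver_common_denominator (f : {poly K}) :
  exists c, [/\ c \in D, c != 0 & c *: f \is a polyOver D].
Proof.
elim/poly_ind: f => [|f a [c [Dc c0 Df]]].
  by exists 1; rewrite rpred1 oner_neq0 scaler0 rpred0; split.
have [x [y [Dx Dy y0 ->]]] := hK a; exists (y * c); split; rewrite ?rpredM ?mulf_neq0 //.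
rewrite scalerDr scalerAl; apply: rpredD.
  apply: rpredM; last exact: polyOverX.
  by rewrite -scalerA; apply: polyOverZ.
by rewrite -mul_polyC -polyCM polyOverC mulrC mulrA divfK // rpredM.
Qed.

Lemma polyOver_horner_sub (A : subringClosed K) (f : {poly K}) x y :
  f \is a polyOver A -> x \in A -> y \in A ->
  exists r, r \in A /\ f.[x] - f.[y] = (x - y) * r.
Proof.
move=> /polyOverP Af Ax Ay.
exists (\sum_(i < size f) f`_i * (\sum_(j < i) x ^+ (i.-1 - j) * y ^+ j)); split.
  by do 2?[apply: rpred_sum => ? _; apply: rpredM => //]; apply: rpredX.
rewrite !horner_coef -sumrB mulr_sumr; apply: eq_bigr => i _.
by rewrite -mulrBr subrXX mulrCA.
Qed.

(** Let c f have coefficients in D, and let d in D be congruent to x modulo c T. Then c (f(x) -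
    f(d)) is a T-multiple of x - d, hence of c, so f(x) - f(d) lies in T. *)
Lemma Int_poly_jaffard T : Theta T ->
  Int_poly [set` D] T =i Int_poly [set` T] T.
Proof.
move=> ThT f; apply/asboolP/asboolP => fT x; last first.
  by move=> Dx; apply: fT; apply: overring_sub.
move=> Tx; have [c [Dc c0 Df]] := polyOver_common_denominator f.
have [d [Dd Td]] := jaffard_dense ThT Tx Dc c0.
have Tf : c *: f \is a polyOver (T : subringClosed K).
  by apply/polyOverP => i; apply: overring_sub; apply/polyOverP.
have [r [Tr]] := polyOver_horner_sub Tf Tx (overring_sub T Dd).
rewrite !hornerZ -mulrBr => e; rewrite -(subrK f.[d] f.[x]).
have -> : f.[x] - f.[d] = (x - d) / c * r by rewrite mulrAC -e mulrC mulKf.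
by apply: rpredD; [apply: rpredM|apply: fT].
Qed.

(** Puts x in the T-span of the intersection of the I S, with m1 = p x and m2 = c x; for S <> T, p x
    = (p / c) (c x). *)
Lemma jaffard_glue (L : fieldType) (phi : {rmorphism K -> L})
    (I : overring D -> set L) T x c :
  (forall S, Theta S -> add_closed (I S)) ->
  (forall S, Theta S -> scalable_by phi S (I S)) ->
  Theta T -> I T x -> c \in D -> c != 0 ->
  (forall S, Theta S -> I S (phi c * x)) ->
  exists m1 m2 u, [/\ forall S, Theta S -> I S m1, forall S, Theta S -> I S m2,
    u \in T & x = m1 + phi u * m2].
Proof.
move=> Iadd IZ ThT ITx Dc c0 Icx.
have [p [Dp Tp Sp]] := jaffard_separate hK hTheta ThT Dc c0.
exists (phi p * x), (phi c * x), ((1 - p) / c); split=> // [S ThS|].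
  have [->|neq] := pselect (S = T); first by apply: IZ => //; apply: overring_sub.
  rewrite -(divfK c0 p) rmorphM -mulrA; apply: IZ => //; first exact: Sp.
  exact: Icx.
by rewrite mulrA -rmorphM divfK // rmorphB rmorph1 mulrBl mul1r addrC subrK.
Qed.

End Gluing.

(** * Gluing invertible ideals *)

Section SubringGluing.
Variables (K L : fieldType) (phi : {rmorphism K -> L}) (D : subringClosed K).
Variable Theta : set (overring D).
Hypotheses (hK : quotient_field D) (hTheta : jaffard_family Theta).
(** The rings stay abstract because the gluing is applied twice: to the rings of polynomials, and to
    D itself with [BT T] equal to T and [phi] the identity. *)
Variables (B : subringClosed L) (BT : overring D -> subringClosed L).
Implicit Types (S T : overring D) (c : K).
Hypothesis phiBT : forall T a, a \in T -> phi a \in BT T.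
Hypothesis BT_denominator : forall T x, Theta T -> x \in BT T ->
  exists c, [/\ c \in D, c != 0 & phi c * x \in B].
Hypothesis BT_cap : forall x, x \in B <-> forall T, Theta T -> x \in BT T.

Lemma BT_add_closed T : add_closed [set` BT T].
Proof. exact: subring_add_closed. Qed.

Lemma submodule_scalable T I : submodule (BT T) I -> scalable_by phi T I.
Proof. by move=> [_ IM] a x Ta Ix; apply: IM => //; apply: phiBT. Qed.

(** Thus B_T = T B, so that extension from B to B_T reduces to extension from D to T, where flatness
    and completeness are available. *)
Lemma BT_split T y : Theta T -> y \in BT T ->
  exists b1 b2 u, [/\ b1 \in B, b2 \in B, u \in T & y = b1 + phi u * b2].
Proof.
move=> ThT Ty; have [c [Dc c0 /BT_cap Bcy]] := BT_denominator ThT Ty.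
have [||b1 [b2 [u [/BT_cap Bb1 /BT_cap Bb2 Tu ->]]]] :=
  @jaffard_glue _ _ _ hK hTheta _ phi (fun S => [set` BT S]) T y c _ _ ThT Ty Dc c0 Bcy.
- by move=> S _; exact: BT_add_closed.
- by move=> S _; exact: submodule_scalable (subring_submodule _).
- by exists b1, b2, u.
Qed.

Lemma phi_subring a : a \in D -> phi a \in B.
Proof. by move=> Da; apply/BT_cap => T _; apply/phiBT/overring_sub. Qed.

Lemma B_sub_BT T b : Theta T -> b \in B -> b \in BT T.
Proof. by move=> ThT /BT_cap; apply. Qed.

Lemma mulset_B_BT T : Theta T -> mulset [set` B] [set` BT T] = [set` BT T].
Proof.
move=> ThT; apply/seteqP; split.
  apply: mulsetP => [|b y Bb Ty]; first exact: BT_add_closed.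
  exact: (rpredM (B_sub_BT ThT Bb) Ty).
by move=> y Ty; rewrite -[y]mul1r; apply: mulset_gen => //; apply: rpred1.
Qed.

(** By [BT_split], M B_T is spanned over T by M; flatness then gives 1 in (M :_D x) T for every
    T. *)
Lemma mem_of_local_ext M x : submodule B M ->
  (forall T, Theta T -> mulset M [set` BT T] x) -> M x.
Proof.
move=> [Madd MM] Mx.
have MZ : scalable_by phi D M by move=> a y Da; apply: MM; apply: phi_subring.
apply: (local_mem hTheta (phi := phi)) => // T ThT.
apply: (mulsetP (X := [set x | mulset (denominators phi D M x) [set` T] 1])) (Mx T ThT).
  exact: denominators_add_closed.
move=> m y Mm Ty; have [b1 [b2 [u [Bb1 Bb2 Tu ->]]]] := BT_split ThT Ty.
have [_ add] := @denominators_add_closed _ _ phi D M T Madd MZ.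
rewrite mulrDr; apply: add.
  rewrite -[m * b1]mul1r -(rmorph1 phi); have Tflat := jaffard_flat hTheta ThT.
  by apply: flat_denominators; rewrite ?rpred1 // mulrC; apply: MM.
rewrite mulrCA; apply: flat_denominators => //; first exact: (jaffard_flat hTheta).
by rewrite mulrC; apply: MM.
Qed.

Lemma eq_of_local_ext I J : submodule B I -> submodule B J ->
  (forall T, Theta T -> mulset I [set` BT T] = mulset J [set` BT T]) -> I = J.
Proof.
move=> Isub Jsub eIJ; apply/seteqP; split=> x Ix; apply: mem_of_local_ext => // T ThT.
  by rewrite -eIJ // -[x]mulr1; apply: mulset_gen => //; apply: rpred1.
by rewrite eIJ // -[x]mulr1; apply: mulset_gen => //; apply: rpred1.
Qed.

(** For an A-module I this says c A <= I <= c^-1 A when c is nonzero; a single c bounds I on both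
    sides. *)
Definition commensurable (A : subringClosed L) (I : set L) c : Prop :=
  I (phi c) /\ forall x, I x -> phi c * x \in A.

Lemma cap_submodule (I : overring D -> set L) :
  (forall T, Theta T -> submodule (BT T) (I T)) ->
  submodule B (\bigcap_(T in Theta) I T).
Proof.
move=> Isub; split; first split.
- by move=> T /Isub[[]].
- by move=> x y Ix Iy T ThT; have [[_ ID] _] := Isub T ThT; apply: ID; [apply: Ix|apply: Iy].
- move=> b x Bb Ix T ThT; have [_ IM] := Isub T ThT.
  by apply: IM; [apply: B_sub_BT|apply: Ix].
Qed.

Lemma cap_ext (I : overring D -> set L) c T :
  (forall S, Theta S -> submodule (BT S) (I S)) ->
  (forall S, Theta S -> commensurable (BT S) (I S) c) -> c \in D -> c != 0 ->
  Theta T -> mulset (\bigcap_(S in Theta) I S) [set` BT T] = I T.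
Proof.
move=> Isub Ic Dc c0 ThT; apply/seteqP; split.
  have [Iadd IM] := Isub T ThT; apply: mulsetP => // x y Ix Ty.
  by rewrite mulrC; apply: IM => //; apply: Ix.
move=> x ITx; have [_ /(_ x ITx) Bcx] := Ic T ThT.
have [d [Dd d0 Bdcx]] := BT_denominator ThT Bcx.
(* One c carries x into B_T, d carries the result into B, and the other c, lying in every I S,
   carries B into I S. *)
have Idcx S : Theta S -> I S (phi (c * d * c) * x).
  move=> ThS; have [_ IM] := Isub S ThS; have [Ic' _] := Ic S ThS.
  by rewrite 2!rmorphM -!mulrA mulrC; apply: IM => //; apply: B_sub_BT.
have [||||m1 [m2 [u [Im1 Im2 Tu ->]]]] :=
  @jaffard_glue _ _ _ hK hTheta _ phi I T x (c * d * c) _ _ ThT ITx _ _ Idcx.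
- by move=> S /Isub[].
- by move=> S ThS; exact: submodule_scalable (Isub S ThS).
- by rewrite !rpredM.
- by rewrite !mulf_neq0.
have [_ mD] := mulset_add (\bigcap_(S in Theta) I S) [set` BT T].
apply: mD; last by rewrite mulrC; apply: mulset_gen => //; apply: phiBT.
by rewrite -[m1]mulr1; apply: mulset_gen => //; apply: rpred1.
Qed.

Lemma inv_ideal_submodule (A : subringClosed L) (I : inv_ideal A) : submodule A I.
Proof. by case: (inv_idealP I). Qed.

Lemma mulset_inv_idealN (A : subringClosed L) (I : inv_ideal A) :
  mulset I (- I : inv_ideal A) = [set` A].
Proof. by have /(congr1 (@inv_ideal_set _ _)) := addrN I. Qed.

(** Inversion swaps the two bounds, so the inverse ideal keeps the same c. *)
Lemma commensurableN T (I : inv_ideal (BT T)) c : c \in T ->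
  commensurable (BT T) I c -> commensurable (BT T) (- I : inv_ideal (BT T)) c.
Proof.
move=> Tc [Ic cI]; have [[N0 ND] NM] := inv_ideal_submodule (- I : inv_ideal (BT T)).
have := mulset_inv_idealN I.
move: (inv_ideal_set (- I)) N0 ND NM => N N0 ND NM IN; split; last first.
  by move=> x Nx; have : mulset I N (phi c * x); [apply: mulset_gen|rewrite IN].
have sub : mulset I N `<=` [set x | N (phi c * x)].
  apply: mulsetP => [|x y Ix Ny /=]; last by rewrite mulrA; apply: NM => //; apply: cI.
  by split=> [|x y Nx Ny]; rewrite /= ?mulr0 // mulrDr; apply: ND.
by rewrite -[phi c]mulr1; apply: sub; rewrite IN; apply: rpred1.
Qed.

(** The intersection of the I T is inverted by the intersection of their inverses: by [cap_ext] the
    product of the two extends to B_T for every T, so it is B. *)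
Lemma glue_inv_ideal (I : forall T, inv_ideal (BT T)) c :
  c \in D -> c != 0 ->
  (forall T, Theta T -> commensurable (BT T) (I T) c) ->
  exists J : inv_ideal B, forall T, Theta T -> mulset J [set` BT T] = I T.
Proof.
move=> Dc c0 Ic; pose N T := - I T : inv_ideal (BT T).
have Nc T : Theta T -> commensurable (BT T) (N T) c.
  by move=> ThT; apply: commensurableN (Ic T ThT); apply: overring_sub.
pose cap (J : forall T, inv_ideal (BT T)) := \bigcap_(T in Theta) (J T : set L).
have cap_sub J : submodule B (cap J).
  by apply: (cap_submodule (I := J)) => T _; apply: inv_ideal_submodule.
have cap_frac (J : forall T, inv_ideal (BT T)) :
    (forall T, Theta T -> commensurable (BT T) (J T) c) ->
    fractional_ideal B (cap J).
  move=> Jc; split; first exact: cap_sub.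
  exists (phi c); split; rewrite ?phi_subring ?fmorph_eq0 // => x Jx.
  by apply/BT_cap => T ThT; have [_] := Jc T ThT; apply; apply: Jx.
have capE (J : forall T, inv_ideal (BT T)) T :
    (forall T, Theta T -> commensurable (BT T) (J T) c) -> Theta T ->
    mulset (cap J) [set` BT T] = J T.
  move=> Jc; apply: (cap_ext (I := J)) Dc c0 => // S _; exact: inv_ideal_submodule.
have cap_mul : mulset (cap I) (cap N) = [set` B].
  apply: eq_of_local_ext.
  - by case: (mulset_fractional (cap_frac I Ic) (cap_frac N Nc)).
  - exact: subring_submodule.
  - move=> T ThT; rewrite -mulset_mulset_subring !capE // mulset_B_BT //.
    exact: mulset_inv_idealN.
have cap_inv : exists J, fractional_ideal B J /\ mulset (cap I) J = [set` B].
  by exists (cap N); split; first exact: cap_frac.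
by exists (InvIdeal (cap_frac I Ic) cap_inv) => T ThT; apply: capE.
Qed.

End SubringGluing.

Lemma commensurableM (K L : fieldType) (phi : {rmorphism K -> L}) (A : subringClosed L)
    (I : set L) c d : submodule A I -> phi d \in A ->
  commensurable phi A I c -> commensurable phi A I (d * c).
Proof.
move=> [_ IM] Ad [Ic cI]; rewrite /commensurable rmorphM; split; first exact: IM.
by move=> x /cI; rewrite -mulrA; apply: rpredM.
Qed.

(** * Invertible ideals of rings of polynomials *)

Section Scaling.
Variables (L : fieldType) (A : subringClosed L).
Implicit Types (I J : set L) (x a b : L).

Lemma scale_set_mem x I y : x != 0 -> scale_set x I y <-> I (x^-1 * y).
Proof.
move=> x0; split=> [[z Iz <-]|Iy]; first by rewrite mulKf.
by exists (x^-1 * y); rewrite ?mulVKf.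
Qed.

Lemma scale_set_fractional a b I : a \in A -> b \in A -> a != 0 -> b != 0 ->
  fractional_ideal A I -> fractional_ideal A (scale_set (a / b) I).
Proof.
move=> Aa Ab a0 b0 [[[I0 ID] IM] [c [Ac c0 cI]]]; split; first split; first split.
- by exists 0; rewrite ?mulr0.
- by move=> _ _ [y Iy <-] [z Iz <-]; exists (y + z); rewrite ?mulrDr //; apply: ID.
- by move=> d _ Ad [y Iy <-]; exists (d * y); [apply: IM|rewrite mulrCA].
exists (b * c); split; rewrite ?rpredM ?mulf_neq0 // => _ [y Iy <-].
by rewrite mulrACA [b * _]mulrC divfK // rpredM // cI.
Qed.

Lemma mulset_scale2 x y I J :
  mulset (scale_set x I) (scale_set y J) = scale_set (x * y) (mulset I J).
Proof.
apply/seteqP; split.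
  apply: mulsetP => [|_ _ [u Iu <-] [v Jv <-]]; last first.
    by exists (u * v); [apply: mulset_gen|rewrite mulrACA].
  have [m0 mD] := mulset_add I J; split; first by exists 0; rewrite ?mulr0.
  by move=> _ _ [u Iu <-] [v Iv <-]; exists (u + v); rewrite ?mulrDr //; apply: mD.
move=> _ [z IJz <-]; have [m0 mD] := mulset_add (scale_set x I) (scale_set y J).
apply: (mulsetP (X := [set z | mulset (scale_set x I) (scale_set y J) (x * y * z)])) IJz.
  by split=> [|u v Iu Iv]; rewrite /= ?mulr0 ?mulrDr //; apply: mD.
move=> u v Iu Jv; rewrite /= mulrACA.
by apply: mulset_gen; [exists u|exists v].
Qed.

Lemma mulset_scalel x I J : mulset (scale_set x I) J = scale_set x (mulset I J).
Proof. by rewrite -{1}(scale_set1 J) mulset_scale2 mulr1. Qed.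

Lemma scale_inv_ideal a b (I : inv_ideal A) : a \in A -> b \in A -> a != 0 -> b != 0 ->
  exists J : inv_ideal A, (J : set L) = scale_set (a / b) I.
Proof.
move=> Aa Ab a0 b0; have fI := scale_set_fractional Aa Ab a0 b0 (inv_idealP I).
have [I' [fI' eI]] := inv_ideal_inv I.
have invI : exists J, fractional_ideal A J /\ mulset (scale_set (a / b) I) J = [set` A].
  exists (scale_set (b / a) I'); split; first exact: scale_set_fractional.
  by rewrite mulset_scale2 eI mulf_div [b * a]mulrC divff ?mulf_neq0 // scale_set1.
by exists (InvIdeal fI invI).
Qed.

End Scaling.

(* The fraction field K(X) is replaced by any field L containing K[X], as      *)
(* conversion problems in {fraction {poly K}} may unfold the quotient and loop. *)
Section PolynomialSubring.
Variables (K : fieldType) (D : subringClosed K).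
Variables (L : fieldType) (iota : {rmorphism {poly K} -> L}).
Hypothesis iota_inj : injective iota.
Local Notation phi := (iota \o polyC).
Variable B : subringClosed L.
Hypothesis phiB : forall c, c \in D -> phi c \in B.
Hypothesis B_poly : forall y, y \in B -> exists f : {poly K}, y = iota f.
Hypothesis B_denominator : forall f : {poly K},
  exists c, [/\ c \in D, c != 0 & phi c * iota f \in B].

Lemma iota_eq0 f : (iota f == 0) = (f == 0).
Proof. by rewrite -(rmorph0 iota) (inj_eq iota_inj). Qed.

(** If b I lies in B, the polynomials g with a nonzero D-multiple of g / b in I form a nonzero ideal
    of K[X]. An element of least degree generates it, by Euclidean division. *)
Lemma inv_ideal_generator (I : set L) : fractional_ideal B I ->
  (exists J, fractional_ideal B J /\ mulset I J = [set` B]) ->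
  exists b g, [/\ b \in B, b != 0, g != 0,
    exists c, [/\ c \in D, c != 0 & I (phi c * (iota g / b))] &
    forall y, I y -> exists q, y = iota g / b * iota q].
Proof.
move=> [[[I0 ID] IM] [b [Bb b0 bI]]] [J [fJ eJ]].
pose P g := exists c, [/\ c \in D, c != 0 & I (phi c * (iota g / b))].
have P_of y : I y -> exists2 g, y = iota g / b & P g.
  move=> Iy; have [g eg] := B_poly (bI _ Iy).
  have ey : y = iota g / b by rewrite -eg mulrC mulKf.
  by exists g => //; exists 1; rewrite rpred1 oner_neq0 rmorph1 mul1r -ey.
have PB g h : P g -> P h -> P (g - h).
  move=> [c [Dc c0 Ic]] [d [Dd d0 Id]]; exists (c * d); split; rewrite ?rpredM ?mulf_neq0 //.
  rewrite rmorphB mulrBl mulrBr; apply: ID.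
    by rewrite [c * d]mulrC rmorphM -mulrA; apply: IM => //; apply: phiB.
  by rewrite rmorphM -mulrA -mulNr; apply: IM => //; rewrite rpredN; apply: phiB.
have PM q g : P g -> P (q * g).
  move=> [c [Dc c0 Ic]]; have [d [Dd d0 Bd]] := B_denominator q.
  exists (d * c); split; rewrite ?rpredM ?mulf_neq0 //.
  have -> : phi (d * c) * (iota (q * g) / b) = phi d * iota q * (phi c * (iota g / b)).
    by rewrite rmorphM rmorphM -[_ * _ / b]mulrA mulrACA.
  exact: IM.
have nz : exists g, P g /\ g != 0.
  apply: contrapT => nP; have I_0 y : I y -> y = 0.
    move=> /P_of[g -> Pg]; suff -> : g = 0 by rewrite rmorph0 mul0r.
    by apply/eqP; apply: contrapT => /negP g0; apply: nP; exists g.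
  have : [set` B] 1 by apply: rpred1.
  rewrite -eJ => /(mulsetP (X := [set 0])) /= e.
  suff /eqP : (1 : L) = 0 by rewrite oner_eq0.
  apply: e => [|x y /I_0 -> _]; last exact: mul0r.
  by split=> // x y -> ->; rewrite addr0.
have nzn : exists n, `[< exists g, [/\ P g, g != 0 & size g = n] >].
  by have [g [Pg g0]] := nz; exists (size g); apply/asboolP; exists g.
case: (ex_minnP nzn) => n /asboolP[g [Pg g0 sg]] nmin.
exists b, g; split=> // y /P_of[h -> Ph].
have [r0|r0] := eqVneq (h %% g) 0; last first.
  have : (n <= size (h %% g)%R)%N.
    apply: nmin; apply/asboolP; exists (h %% g); split=> //.
    by rewrite -(addKr (h %/ g * g) (h %% g)) -divp_eq addrC; apply: PB => //; apply: PM.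
  by rewrite -sg leqNgt ltn_modp g0.
exists (h %/ g); rewrite {1}(divp_eq h g) r0 addr0 rmorphM.
by rewrite -mulrA mulrC.
Qed.

Lemma inv_ideal_normalize (I : inv_ideal B) :
  exists (x : L) (J : inv_ideal B) (c : K),
    [/\ x != 0, c \in D, c != 0, commensurable phi B J c & (I : set L) = scale_set x J].
Proof.
have [b [g [Bb b0 g0 [c [Dc c0 Ic]] genI]]] :=
  inv_ideal_generator (inv_idealP I) (inv_ideal_inv I).
have [[[I0 ID] IM] _] := inv_idealP I.
have [I' [[[[I'0 I'D] I'M] _] eI]] := inv_ideal_inv I.
have [d [Dd d0 Bdg]] := B_denominator g.
have phi0 a : a != 0 -> phi a != 0 by rewrite iota_eq0 polyC_eq0.
have tg0 : iota g != 0 by rewrite iota_eq0.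
pose x := iota g / b; have x0 : x != 0 by rewrite mulf_neq0 ?invr_eq0.
(* The factor d makes x^-1 = (d b) / (d g) a quotient of two elements of B. *)
have [|||J eJ] := @scale_inv_ideal _ B (phi d * b) (phi d * iota g) I _ Bdg.
- by rewrite rpredM ?phiB.
- by rewrite mulf_neq0 ?phi0.
- by rewrite mulf_neq0 ?phi0.
have {}eJ : (J : set L) = scale_set x^-1 I.
  by rewrite eJ -mulf_div divff ?phi0 // mul1r /x invf_div.
(* The upper bound is a finite generation argument: write 1 as the sum of y_i z_i with y_i in I and
   z_i in I'. For u in I, x^-1 u is the sum of the (x^-1 y_i) (u z_i), where u z_i is in B and x^-1
   y_i is a polynomial; a common denominator of these polynomials works for all u. *)
pose X := [set z | exists e, [/\ e \in D, e != 0 &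
  forall y, (I : set L) y -> phi e * (x^-1 * y * z) \in B]].
have [e [De e0 Be]] : X 1.
  have : [set` B] 1 by apply: rpred1.
  rewrite -eI; apply: mulsetP => [|y z Iy I'z].
    split; first by exists 1; rewrite rpred1 oner_neq0; split=> // y _; rewrite !mulr0 rpred0.
    move=> y z [e [De e0 Be]] [f [Df f0 Bf]].
    exists (e * f); split; rewrite ?rpredM ?mulf_neq0 // => u Iu; rewrite rmorphM !mulrDr.
    apply: rpredD; last by rewrite -mulrA; apply: rpredM; [apply: phiB|apply: Bf].
    by rewrite -mulrA mulrCA; apply: rpredM; [apply: phiB|apply: Be].
  have [q ->] := genI y Iy; have [e [De e0 Be]] := B_denominator q.
  exists e; split=> // u Iu.
  have -> : phi e * (x^-1 * u * (iota g / b * iota q * z)) =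
      phi e * iota q * (u * z).
    by rewrite -/x mulrACA [x^-1 * _]mulrA mulVf // mul1r [LHS]mulrA.
  apply: rpredM => //; have : mulset I I' (u * z) by apply: mulset_gen.
  by rewrite eI.
exists x, J, (c * e); split=> //; [exact: rpredM|exact: mulf_neq0| |]; last first.
  by rewrite eJ scale_setA divff // scale_set1.
rewrite eJ; split.
  apply/scale_set_mem; first by rewrite invr_eq0.
  rewrite invrK [c * e]mulrC rmorphM mulrCA; apply: IM; first exact: phiB.
  by rewrite mulrC.
move=> _ [y Iy <-]; rewrite rmorphM -mulrA; apply: rpredM; first exact: phiB.
by have := Be y Iy; rewrite mulr1.
Qed.

(** The lower bound gives c = x y with y a polynomial. The upper bound makes c x j, hence x, a
    polynomial, so x divides a nonzero constant in K[X]. *)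
Lemma commensurable_const (J : set K) j (x : L) c :
  c != 0 -> J j -> j != 0 ->
  commensurable phi B (scale_set x (ext_set phi B J)) c ->
  exists2 a : K, a != 0 & x = phi a.
Proof.
move=> c0 Jj j0 [[y Jy exy] cJ].
have polyD : add_closed [set y : L | exists q : {poly K}, y = iota q].
  split; first by exists 0; rewrite rmorph0.
  by move=> _ _ [q ->] [r ->]; exists (q + r); rewrite rmorphD.
have [q eq] : exists q : {poly K}, y = iota q.
  apply: (mulsetP polyD) Jy => _ b [a _ <-] /B_poly[f ->].
  by exists (a%:P * f); rewrite rmorphM.
have [p ep] : exists p : {poly K}, x = iota p.
  have [|f ef] := B_poly (cJ (x * phi j) _).
    exists (phi j) => //; rewrite -[phi j]mulr1; apply: mulset_gen; last exact: rpred1.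
    by exists j.
  have cj0 : c * j != 0 by rewrite mulf_neq0.
  have e1 : phi c * phi j * iota (c * j)^-1%:P = 1.
    by rewrite -[RHS](rmorph1 phi) -(divff cj0) !rmorphM.
  by exists ((c * j)^-1%:P * f); rewrite rmorphM -ef mulrC [phi c * _]mulrCA -mulrA e1 mulr1.
have epq : p * q = c%:P.
  by apply: iota_inj; rewrite rmorphM -ep -eq exy.
have p0 : p != 0.
  by apply/eqP => p0; move/eqP: epq; rewrite p0 mul0r eq_sym polyC_eq0 (negPf c0).
have sp : (size p <= 1)%N.
  have := @dvdp_leq _ p c%:P; rewrite polyC_eq0 size_polyC c0; apply=> //.
  by rewrite -epq dvdp_mulr.
exists p`_0; last by rewrite ep [in LHS](size1_polyC sp).
by move: p0; rewrite {1}(size1_polyC sp) polyC_eq0.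
Qed.

End PolynomialSubring.

(** * Local Picard groups *)

Section SameKernel.
Variables (G0 G H : zmodType) (a : {additive G0 -> G}) (b : {additive G0 -> H}).
Hypotheses (a_surj : forall g, exists x, a x = g).
Hypotheses (ker_ab : forall x, a x = 0 -> b x = 0).

Definition factor_map (g : G) : H := b (projT1 (cid (a_surj g))).

Lemma factor_mapE x : factor_map (a x) = b x.
Proof.
rewrite /factor_map; case: cid => y /= e; apply/eqP; rewrite -subr_eq0 -raddfB.
by apply/eqP/ker_ab; rewrite raddfB e subrr.
Qed.

Lemma factor_map_is_additive : zmod_morphism factor_map.
Proof.
move=> g h; have [x <-] := a_surj g; have [y <-] := a_surj h.
by rewrite -raddfB !factor_mapE raddfB.
Qed.

HB.instance Definition _ :=
  GRing.isZmodMorphism.Build G H factor_map factor_map_is_additive.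

Lemma factor_map_isomorphic : (forall h, exists x, b x = h) ->
  (forall x, b x = 0 -> a x = 0) -> isomorphic G H.
Proof.
move=> b_surj ker_ba; exists factor_map.
exists (fun h => a (projT1 (cid (b_surj h)))) => [g|h]; last first.
  by case: cid => x /= <-; rewrite factor_mapE.
case: cid => x /= e; have [y ey] := a_surj g.
apply/eqP; rewrite -ey -subr_eq0 -raddfB; apply/eqP/ker_ba.
by rewrite raddfB e -ey factor_mapE subrr.
Qed.

End SameKernel.

Section LocalPicardClass.
Variables (K L : fieldType) (phi : {rmorphism K -> L}).
Variables (A : subringClosed K) (B : subringClosed L).
Hypothesis sAB : forall a, a \in A -> phi a \in B.

Definition lpic_class (I : inv_ideal B) : LPic sAB :=
  \pi_(LPic sAB) (\pi_(Pic B) I).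

Lemma lpic_class_is_additive : zmod_morphism lpic_class.
Proof. by move=> I J; rewrite /lpic_class !raddfB. Qed.

HB.instance Definition _ := GRing.isZmodMorphism.Build
  (inv_ideal B) (LPic sAB) lpic_class lpic_class_is_additive.

Lemma lpic_class_surj c : exists I, lpic_class I = c.
Proof. by exists (repr (repr c)); rewrite /lpic_class !reprK. Qed.

Lemma pi_Pic_eq (I J : inv_ideal B) :
  \pi_(Pic B) I = \pi_(Pic B) J <->
  exists2 x : L, x != 0 & (I : set L) = scale_set x J.
Proof.
have NI X := mulset_inv_idealN (X : inv_ideal B).
split=> [/eqP|[x x0 eI]].
  rewrite -Quotient.idealrBE => /asboolP[x x0 eI]; exists x => //.
  rewrite -(mulset_scale x (inv_ideal_submodule J)) -eI.
  by have /(congr1 (@inv_ideal_set _ _)) := subrK J I.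
apply/eqP; rewrite -Quotient.idealrBE; apply/asboolP; exists x => //.
rewrite [LHS](_ : _ = mulset I (- J : inv_ideal B)) // eI.
rewrite -(mulset_scale x (inv_ideal_submodule J)) -mulsetA NI.
exact/mulset_scale/subring_submodule.
Qed.

Lemma lpic_class_scale (I J : inv_ideal B) x : x != 0 ->
  (I : set L) = scale_set x J -> lpic_class I = lpic_class J.
Proof. by move=> x0 eI; congr (\pi_(LPic sAB) _); apply/pi_Pic_eq; exists x. Qed.

(** Eliminates both quotients, by principal ideals and by extended ideals, at once. *)
Lemma lpic_class_eq0 (I : inv_ideal B) : lpic_class I = 0 <->
  exists x (J : inv_ideal A), x != 0 /\ (I : set L) = scale_set x (ext_set phi B J).
Proof.
have -> : (lpic_class I = 0) <-> exists c, \pi_(Pic B) I = Pic_ext sAB c.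
  split=> [e|Ic].
    have /eqP : \pi_(LPic sAB) (\pi_(Pic B) I) = \pi_(LPic sAB) 0 by rewrite raddf0.
    by rewrite -Quotient.idealrBE subr0 => /asboolP.
  rewrite -[RHS](raddf0 \pi_(LPic sAB)); apply/eqP.
  by rewrite -Quotient.idealrBE subr0; apply/asboolP.
split=> [[c]|[x [J [x0 eI]]]].
  rewrite -[c]reprK Pic_ext_pi => /pi_Pic_eq[x x0 eI].
  by exists x, (repr c).
exists (\pi_(Pic A) J); rewrite Pic_ext_pi.
by apply/pi_Pic_eq; exists x.
Qed.

End LocalPicardClass.

Lemma ext_set_idfun (L : fieldType) (B : subringClosed L) I :
  ext_set idfun B I = mulset I [set` B].
Proof. by rewrite /ext_set image_id. Qed.

Lemma scale_ext_set (K L : fieldType) (phi : {rmorphism K -> L}) (B : subringClosed L) a I :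
  scale_set (phi a) (ext_set phi B I) = ext_set phi B (scale_set a I).
Proof.
rewrite /ext_set.
have -> : phi @` scale_set a I = scale_set (phi a) (phi @` I).
  apply/seteqP; split=> [_ [_ [y Iy <-] <-]|_ [_ [y Iy <-] <-]].
    by exists (phi y); [exists y|rewrite rmorphM].
  by exists (a * y); [exists y|rewrite rmorphM].
exact/esym/mulset_scalel.
Qed.

(** * The decomposition for abstract rings of polynomials *)

Section Decomposition.
Variables (K : fieldType) (D : subringClosed K) (Theta : set (overring D)).
Hypotheses (hK : quotient_field D) (hTheta : jaffard_family Theta).
Variables (L : fieldType) (iota : {rmorphism {poly K} -> L}).
Hypothesis iota_inj : injective iota.
Local Notation phi := (iota \o polyC).
Variables (B : subringClosed L) (BT : overring D -> subringClosed L).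
Implicit Types (S T : overring D) (c : K).
Hypothesis phiB : forall c, c \in D -> phi c \in B.
Hypothesis phiBT : forall T c, c \in T -> phi c \in BT T.
Hypothesis B_poly : forall y, y \in B -> exists f, y = iota f.
Hypothesis BT_poly : forall T y, Theta T -> y \in BT T -> exists f, y = iota f.
Hypothesis B_denominator : forall f,
  exists c, [/\ c \in D, c != 0 & phi c * iota f \in B].
Hypothesis BT_cap : forall y, y \in B <-> forall T, Theta T -> y \in BT T.

Lemma BT_denominator T y : Theta T -> y \in BT T ->
  exists c, [/\ c \in D, c != 0 & phi c * y \in B].
Proof. by move=> ThT /(BT_poly ThT)[f ->]. Qed.

(** The bounds c B_T and c^-1 B_T of I B_T coincide once c is a unit of T. *)
Lemma commensurable_unit T (I : set L) c : Theta T -> commensurable phi B I c ->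
  unit_in T c -> mulset I [set` BT T] = [set` BT T].
Proof.
move=> ThT [Ic cI] [Tc [d Td cd1]]; have pd := phiBT Td.
have pcd : phi c * phi d = 1 by rewrite -rmorphM cd1 rmorph1.
apply/seteqP; split.
  apply: mulsetP => [|y z /cI cy Tz]; first exact: subring_add_closed.
  have -> : y * z = phi d * (phi c * y) * z.
    by rewrite [phi d * _]mulrA [phi d * _]mulrC pcd mul1r.
  apply: rpredM => //; apply: rpredM => //; exact: (B_sub_BT BT_cap).
move=> y Ty; rewrite -[y]mul1r -pcd -mulrA.
by apply: mulset_gen => //; apply: rpredM.
Qed.

Lemma commensurable_ext T (I : set L) c : Theta T -> commensurable phi B I c ->
  commensurable phi (BT T) (mulset I [set` BT T]) c.
Proof.
move=> ThT [Ic cI]; split.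
  have T1 : [set` BT T] 1 by apply: rpred1.
  by have := mulset_gen Ic T1; rewrite mulr1.
apply: (mulsetP (X := [set y | phi c * y \in BT T])).
  split=> [|x y Tx Ty]; rewrite /= ?mulr0 ?rpred0 // mulrDr.
  exact: rpredD.
by move=> x y /cI cx Ty; rewrite /= mulrA; apply: rpredM => //; apply: (B_sub_BT BT_cap).
Qed.

Lemma ext_set_BT T (J : set K) : Theta T ->
  mulset (ext_set phi B J) [set` BT T] = ext_set phi (BT T) J.
Proof. by move=> ThT; rewrite /ext_set -mulsetA (mulset_B_BT BT_cap). Qed.

Lemma ext_set_overring T (J : set K) :
  ext_set phi (BT T) (mulset J [set` T]) = ext_set phi (BT T) J.
Proof.
have phiT c : c \in T -> phi c \in BT T by apply: phiBT.
rewrite ext_set_mul (ext_set1 phiT); exact/mulset_subring/mulset_submodule.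
Qed.

Lemma idfun_commensurable T (J : inv_ideal T) :
  exists c, [/\ c \in D, c != 0 & commensurable idfun T J c].
Proof.
have [[[J0 JD] JM] [b [Tb b0 bJ]]] := inv_idealP J.
have [j Jj j0] : exists2 j, (J : set K) j & j != 0.
  have [J' [_ eJ]] := inv_ideal_inv J; apply: contrapT => nJ.
  have : [set` T] 1 by apply: rpred1.
  rewrite -eJ => /(mulsetP (X := [set 0])) /= e.
  suff /eqP : (1 : K) = 0 by rewrite oner_eq0.
  apply: e => [|x y Jx _]; first by split=> // x y -> ->; rewrite addr0.
  have [->|x0] := eqVneq x 0; first exact: mul0r.
  by case: nJ; exists x.
have [b1 [b2 [Db1 Db2 b20 eb]]] := hK b; have [j1 [j2 [Dj1 Dj2 j20 ej]]] := hK j.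
have b1E : b1 = b2 * b by rewrite eb mulrC divfK.
have j1E : j1 = j2 * j by rewrite ej mulrC divfK.
(* The numerators b1 = b2 b and j1 = j2 j lie in D; b1 j1 is a T-multiple both of j, which is in J,
   and of b, which carries J into T. *)
exists (b1 * j1); split; first exact: rpredM.
  by rewrite b1E j1E !mulf_neq0.
split=> [|x Jx] /=.
  by rewrite j1E mulrA; apply: JM => //; apply: overring_sub; apply: rpredM.
rewrite [b1 * _]mulrC b1E -!mulrA; apply: rpredM; first exact: overring_sub.
by apply: rpredM; [exact: overring_sub|exact: bJ].
Qed.

Definition ext_BT T (ThT : Theta T) : inv_ideal B -> inv_ideal (BT T) :=
  @ext_ideal L L idfun B (BT T) (fun b => @B_sub_BT _ _ _ _ _ _ BT_cap T b ThT).

Lemma ext_BTE T (ThT : Theta T) (I : inv_ideal B) :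
  (ext_BT ThT I : set L) = mulset I [set` BT T].
Proof. exact: ext_set_idfun. Qed.

Local Notation G := (fun T : set_type Theta => LPic (@phiBT (\val T))).

Definition local_class (I : inv_ideal B) (T : set_type Theta) : G T :=
  lpic_class (@phiBT (\val T)) (ext_BT (set_mem (valP T)) I).

(** After normalizing I = x J with bound c, I B_T = x B_T at every T where c is a unit; local
    finiteness bounds the remaining T. *)
Lemma local_class_finite I : finite_set [set T | local_class I T != 0].
Proof.
have [x [J [c [x0 Dc c0 Jc eI]]]] :=
  inv_ideal_normalize iota_inj phiB B_poly B_denominator I.
have [_ _ _ _ /(_ c Dc c0) fin] := hTheta.
apply: sub_finite_set (finite_preimage (f := \val) _ fin); last first.
  by move=> ? ? _ _; apply: val_inj.
move=> T /= nz; have ThT := set_mem (valP T); split=> // Tc.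
(* The group is additive, so [0] stands for the trivial ideal T. *)
move/eqP: nz; apply; apply/lpic_class_eq0; exists x, 0; split=> //.
rewrite ext_BTE eI mulset_scalel (commensurable_unit ThT Jc Tc).
by congr (scale_set x _); exact/esym/(ext_set1 (@phiBT (\val T))).
Qed.

Definition local_classes (I : inv_ideal B) : direct_sum G := DirectSum (local_class_finite I).

Lemma local_classes_is_additive : zmod_morphism local_classes.
Proof.
move=> I J; apply: direct_sum_ext => T.
by rewrite /= /local_class /ext_BT !raddfB.
Qed.

HB.instance Definition _ := GRing.isZmodMorphism.Build
  (inv_ideal B) (direct_sum G) local_classes local_classes_is_additive.

Lemma inv_ideal_one_commensurable T c :
  c \in T -> commensurable phi (BT T) (inv_ideal_one (BT T)) c.
Proof. by move=> Tc; split=> [|y Ty]; [exact: phiBT|apply: rpredM => //; exact: phiBT]. Qed.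

Lemma BT_normalize T (I : inv_ideal (BT T)) : Theta T ->
  exists J : inv_ideal (BT T), lpic_class (@phiBT T) J = lpic_class (@phiBT T) I /\
    exists c, [/\ c \in D, c != 0 & commensurable phi (BT T) J c].
Proof.
move=> ThT.
have [||f|x [J [c [x0 Dc c0 Jc eI]]]] :=
  @inv_ideal_normalize K D L iota iota_inj (BT T) _ _ _ I.
- by move=> c Dc; apply/phiBT/overring_sub.
- by move=> y; apply: BT_poly.
- have [c [Dc c0 Bc]] := B_denominator f; exists c; split=> //.
  exact: (B_sub_BT BT_cap ThT Bc).
- exists J; split; last by exists c.
  by rewrite (lpic_class_scale (@phiBT T) x0 eI).
Qed.

Lemma local_classes_surj h : exists I, local_classes I = h.
Proof.
(* Taking the trivial ideal wherever h vanishes, and outside Theta, leaves finitely many components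
   that need a common c. *)
have rep T : exists J : inv_ideal (BT T),
    [/\ forall p : T \in Theta, lpic_class (@phiBT T) J = h (exist _ T p),
      (forall p : T \in Theta, h (exist _ T p) = 0) -> J = inv_ideal_one (BT T) &
      Theta T -> exists c, [/\ c \in D, c != 0 & commensurable phi (BT T) J c]].
  have [h0|nh0] := pselect (forall p : T \in Theta, h (exist _ T p) = 0).
    exists (inv_ideal_one (BT T)); split=> // [p|_].
      by rewrite h0 (raddf0 (lpic_class _)).
    exists 1; rewrite rpred1 oner_neq0; split=> //.
    by apply: inv_ideal_one_commensurable; apply: rpred1.
  have [p0|nT] := pselect (T \in Theta : Prop); last by case: nh0 => p; case: nT.
  have [I eI] := lpic_class_surj (h (exist _ T p0)).
  have [J [eJ Jc]] := BT_normalize I (set_mem p0).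
  by exists J; split=> // p; rewrite eJ eI (bool_irrelevance p p0).
pose J T := projT1 (cid (rep T)).
have JP T : [/\ forall p : T \in Theta, lpic_class (@phiBT T) (J T) = h (exist _ T p),
      (forall p : T \in Theta, h (exist _ T p) = 0) -> J T = inv_ideal_one (BT T) &
      Theta T -> exists c, [/\ c \in D, c != 0 & commensurable phi (BT T) (J T) c]].
  by rewrite /J; case: cid.
pose N := \val @` [set T | h T != 0].
have [c [Dc c0 Jc]] : exists c, [/\ c \in D, c != 0 &
    forall T, N T -> commensurable phi (BT T) (J T) c].
  apply: (finite_common_multiple (P := fun T => commensurable phi (BT T) (J T))).
  - move=> T d e Dd d0; apply: commensurableM; first exact: inv_ideal_submodule.
    exact/phiBT/overring_sub.
  - exact/finite_image/direct_sum_finite.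
  - by move=> _ [T _ <-]; have [_ _] := JP (\val T); apply; apply: set_mem (valP T).
have [I eI] : exists I : inv_ideal B, forall T, Theta T -> mulset I [set` BT T] = J T.
  apply: (glue_inv_ideal hK hTheta phiBT BT_denominator BT_cap Dc c0) => T ThT.
  have [/Jc //|nN] := pselect (N T); have [_ J1 _] := JP T; rewrite J1.
    by apply: inv_ideal_one_commensurable; apply: overring_sub.
  move=> p; apply: contrapT => h0; apply: nN.
  by exists (exist _ T p) => //=; apply/eqP.
exists I; apply: direct_sum_ext => -[T p]; have [Jh _ _] := JP T; rewrite -Jh.
by congr (lpic_class _ _); apply: inv_ideal_ext; rewrite ext_BTE /= eI //; apply: set_mem.
Qed.

Lemma local_classes_ker I : lpic_class phiB I = 0 -> local_classes I = 0.
Proof.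
move=> /lpic_class_eq0[x [J [x0 eI]]]; apply: direct_sum_ext => T.
apply/lpic_class_eq0; have ThT := set_mem (valP T).
have sDT d : d \in D -> idfun d \in \val T by apply: overring_sub.
exists x, (ext_ideal sDT J); split=> //.
rewrite ext_BTE eI mulset_scalel ext_set_BT //; congr (scale_set x _).
by rewrite -(ext_set_overring (\val T) J) -(ext_set_idfun (\val T) J).
Qed.

(** The scalar x between I B_T and an extended ideal is a constant by [commensurable_const], so it
    can be absorbed into the ideal of T. *)
Lemma local_ideal T (I : inv_ideal B) c : Theta T ->
  commensurable phi B I c -> c \in D -> c != 0 ->
  (forall p : Theta T, lpic_class (@phiBT T) (ext_BT p I) = 0) ->
  exists J : inv_ideal T, mulset I [set` BT T] = ext_set phi (BT T) J.
Proof.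
move=> ThT Ic Dc c0 /(_ ThT)/lpic_class_eq0[x [J [x0]]]; rewrite ext_BTE => eI.
have [Jadd JM] := inv_ideal_submodule J.
have [d [Dd d0 [Jd _]]] := idfun_commensurable J.
have := commensurable_ext ThT Ic; rewrite eI => xJc.
have [a a0 ex] := commensurable_const iota_inj (fun y => @BT_poly T y ThT) c0 Jd d0 xJc.
have [b1 [b2 [Db1 Db2 b20 ea]]] := hK a.
have b10 : b1 != 0 by apply: contraNneq a0 => b10; rewrite ea b10 mul0r.
have [J' eJ'] := scale_inv_ideal J (overring_sub T Db1) (overring_sub T Db2) b10 b20.
exists J'; rewrite eJ' -ea ex; exact: scale_ext_set.
Qed.

Lemma ker_local_classes I : local_classes I = 0 -> lpic_class phiB I = 0.
Proof.
move=> I0; apply/lpic_class_eq0.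
have [x [J [c [x0 Dc c0 Jc eI]]]] :=
  inv_ideal_normalize iota_inj phiB B_poly B_denominator I.
have {I0} J0 T (p : Theta T) : lpic_class (@phiBT T) (ext_BT p J) = 0.
  have := congr1 (fun h : direct_sum G => h (exist _ T (mem_set p))) I0.
  rewrite /= /local_class /= => <-; apply/esym/(lpic_class_scale _ x0).
  by rewrite !ext_BTE eI mulset_scalel.
(* Where c is a unit of T the ideal T itself is chosen, so that a common bound is needed over
   finitely many T only. *)
have rep T : exists JT : inv_ideal T,
    (Theta T -> mulset J [set` BT T] = ext_set phi (BT T) JT) /\
    (unit_in T c -> JT = inv_ideal_one T).
  have [ThT|nT] := pselect (Theta T); last by exists (inv_ideal_one T).
  have [Tc|nTc] := pselect (unit_in T c); last first.
    by have [JT eJT] := local_ideal ThT Jc Dc c0 (J0 T); exists JT.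
  exists (inv_ideal_one T); split=> // _.
  by rewrite (commensurable_unit ThT Jc Tc) [RHS](ext_set1 (@phiBT T)).
pose JT T := projT1 (cid (rep T)).
have JTP T : (Theta T -> mulset J [set` BT T] = ext_set phi (BT T) (JT T)) /\
    (unit_in T c -> JT T = inv_ideal_one T).
  by rewrite /JT; case: cid.
have [_ _ _ _ /(_ c Dc c0) fin] := hTheta.
have [e [De e0 Je]] : exists e, [/\ e \in D, e != 0 &
    forall T, [set T | Theta T /\ ~ unit_in T c] T -> commensurable idfun T (JT T) e].
  apply: (finite_common_multiple (P := fun T => commensurable idfun T (JT T))) => //.
    move=> T d f Dd d0; apply: commensurableM; first exact: inv_ideal_submodule.
    exact: overring_sub.
  by move=> T _; apply: idfun_commensurable.
have [J1 eJ1] : exists J1 : inv_ideal D, forall T, Theta T -> mulset J1 [set` T] = JT T.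
  apply: (glue_inv_ideal (phi := idfun) (BT := fun T => T) hK hTheta _ _ _ De e0) => //.
  - move=> T x1 ThT Tx1; have [a [b [Da Db b0 ->]]] := hK x1.
    by exists b; rewrite /= mulrC divfK.
  - move=> y; split=> [Dy T _|]; first exact: overring_sub.
    exact: (jaffard_overring_cap hTheta).
  move=> T ThT; have [Tc|nTc] := pselect (unit_in T c); last exact: Je.
  have [_ ->] := JTP T; last exact: Tc.
  by split=> [|y Ty]; [exact: overring_sub|apply: rpredM => //; exact: overring_sub].
exists x, J1; split=> //; rewrite eI; congr (scale_set x _).
apply: (eq_of_local_ext hK hTheta phiBT BT_denominator BT_cap).
- exact: inv_ideal_submodule.
- exact: mulset_submodule.
move=> T ThT; rewrite ext_set_BT // -(ext_set_overring T J1) eJ1 //.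
by have [->] := JTP T.
Qed.

Lemma LPic_decomposition : isomorphic (LPic phiB) (direct_sum G).
Proof.
apply: (@factor_map_isomorphic _ _ _ (lpic_class phiB) local_classes).
- exact: lpic_class_surj.
- exact: local_classes_ker.
- exact: local_classes_surj.
- exact: ker_local_classes.
Qed.

End Decomposition.

(** * Rings of integer-valued polynomials *)

Section IntDenominator.
Variables (K : fieldType) (D : subringClosed K) (E : set K).
Hypothesis hK : quotient_field D.
Hypothesis hE : exists d : K, [/\ d \in D, d != 0 & forall x, E x -> d * x \in D].

Lemma Int_poly_denominator (f : {poly K}) :
  exists c, [/\ c \in D, c != 0 & c%:P * f \in Int_poly E D].
Proof.
have [d [Dd d0 Ed]] := hE.
elim/poly_ind: f => [|f a [c [Dc c0 /asboolP cf]]].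
  exists 1; rewrite rpred1 oner_neq0 mulr0; split=> //.
  by apply/asboolP => x _; rewrite horner0 rpred0.
have [u [v [Du Dv v0 ->]]] := hK a.
(* In f X + a, c clears the values of f on E, d clears the additional factor x in E, and v clears
   a. *)
exists (c * d * v); split; [by rewrite !rpredM|by rewrite !mulf_neq0|].
apply/asboolP => x Ex; rewrite hornerM hornerC hornerMXaddC mulrDr.
apply: rpredD; last first.
  have -> : c * d * v * (u / v) = c * d * u by rewrite -[LHS]mulrA [v * _]mulrC divfK.
  by rewrite !rpredM.
have := cf x Ex; rewrite hornerM hornerC => Dcf.
have -> : c * d * v * (f.[x] * x) = v * (c * f.[x] * (d * x)).
  by rewrite [c * f.[x] * _]mulrACA [RHS]mulrA [v * _]mulrC.
by do 2![apply: rpredM => //]; apply: Ed.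
Qed.

End IntDenominator.

Section IntDecomposition.
Variables (K : fieldType) (D : subringClosed K) (Theta : set (overring D)).
Hypotheses (hK : quotient_field D) (hD : [set` D] <> [set: K]).
Hypothesis hTheta : jaffard_family Theta.
Variable E : set K.
Hypothesis hE : exists d : K, [/\ d \in D, d != 0 & forall x, E x -> d * x \in D].
Local Notation iota := (@tofrac {poly K}).

Lemma tofrac_inj : injective iota.
Proof. by move=> f g /eqP; rewrite tofrac_eq => /eqP. Qed.

Lemma Int_fracP (F : set K) (A : subringClosed K) f :
  iota f \in Int F A <-> f \in Int_poly F A.
Proof.
by split=> [/asboolP[g Ag /tofrac_inj->]|Af] //; apply/asboolP; exists f.
Qed.

Lemma Int_is_poly (F : set K) (A : subringClosed K) y :
  y \in Int F A -> exists f, y = iota f.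
Proof. by move=> /asboolP[f _ ->]; exists f. Qed.

Lemma Int_denominator f :
  exists c, [/\ c \in D, c != 0 & const_frac K c * iota f \in Int E D].
Proof.
have [c [Dc c0 cf]] := Int_poly_denominator hK hE f.
exists c; split=> //; suff -> : const_frac K c * iota f = iota (c%:P * f).
  exact/Int_fracP.
by rewrite rmorphM.
Qed.

Lemma jaffard_nonempty : exists T, Theta T.
Proof.
apply: contrapT => nT; apply: hD; apply/seteqP; split=> // x _ /=.
by apply: (jaffard_overring_cap hTheta) => T ThT; case: nT; exists T.
Qed.

Lemma Int_cap (F : overring D -> set K) y :
  (forall T, Theta T -> Int_poly E T =i Int_poly (F T) T) ->
  y \in Int E D <-> forall T, Theta T -> y \in Int (F T) T.
Proof.
move=> EF; split=> [/asboolP[f /asboolP Ef ->] T ThT|yF].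
  apply/Int_fracP; rewrite -EF //; apply/asboolP => x Ex.
  exact/overring_sub/Ef.
(* Some member of Theta must certify that y is a polynomial; D <> K provides it. *)
have [T0 ThT0] := jaffard_nonempty; have [f ey] := Int_is_poly (yF T0 ThT0).
rewrite ey; apply/Int_fracP/asboolP => x Ex.
apply: (jaffard_overring_cap hTheta) => T ThT.
have := yF T ThT; rewrite ey => /Int_fracP; rewrite -EF // => /asboolP; exact.
Qed.

(** Letting the set vary with T covers both isomorphisms: F T = E for the first, E = D and F T = T
    for the second. *)
Lemma LPicInt_decomposition (F : overring D -> set K) :
  (forall T, Theta T -> Int_poly E T =i Int_poly (F T) T) ->
  isomorphic (LPicInt E D)
    (direct_sum (fun T : set_type Theta => LPicInt (F (\val T)) (\val T))).
Proof.
move=> EF.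
apply: (@LPic_decomposition K D Theta hK hTheta _ iota tofrac_inj (Int E D)
  (fun T => Int (F T) T) (@const_Int K E D) (fun T => @const_Int K (F T) T)).
- exact: Int_is_poly.
- by move=> T y _; apply: Int_is_poly.
- exact: Int_denominator.
- by move=> y; apply: Int_cap.
Qed.

End IntDecomposition.

Theorem corollary7p8 (K : fieldType) (D : subringClosed K)
    (hK : quotient_field D) (hD : [set` D] <> [set: K])
    (Theta : set (overring D)) (hTheta : jaffard_family Theta)
    (E : set K)
    (hE : exists d : K, [/\ d \in D, d != 0 & forall x, E x -> d * x \in D]) :
  isomorphic (LPicInt E D)
    (direct_sum (fun T : set_type Theta => LPicInt E (\val T))) /\
  isomorphic (LPicInt [set` D] D)
    (direct_sum (fun T : set_type Theta => LPicInt [set` \val T] (\val T))).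
Proof.
split.
  exact: (@LPicInt_decomposition _ _ _ hK hD hTheta _ hE (fun=> E)).
apply: (@LPicInt_decomposition _ _ _ hK hD hTheta _ _ (fun T => [set` T])).
  by exists 1; rewrite rpred1 oner_neq0; split=> // x Dx; rewrite mul1r.
by move=> T ThT; apply: (Int_poly_jaffard hK hTheta).
Qed.
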